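(* Let $M$ be a nonlinear Lipschitz-continuously differentiable hypersurface in $\mathbb{R}^{n+1}$. If $\mathscr{A}$ is a family of (affine) hyperplanes in $\mathbb{R}^{n+1}$ such that $\bigcup \mathscr{A} \supseteq M$, then $\dim_{\mathcal{H}} \bigcup \mathscr{A} = n+1$.
   Context: A topological $d$-submanifold of $\mathbb{R}^N$ is a topological subspace $M\subseteq\mathbb{R}^N$ that is a topological $d$-manifold in the induced topology; all manifolds are assumed connected. A hypersurface is a submanifold of codimension $1$. A $C^1$ submanifold is Lipschitz-continuously differentiable iff for every $p\in M$, in a neighbourhood of $p$ the set $M$ coincides (up to a rigid motion) with the graph of a $C^1$ map $f$ with locally Lipschitz differential. A submanifold $M$ of $\mathbb{R}^N$ is linear iff there is an affine subspace $\Pi\subseteq\mathbb{R}^N$ such that $M$ is an open subset of $\Pi$; otherwise it is nonlinear. $\dim_{\mathcal{H}}$ denotes Hausdorff dimension, and $\bigcup\mathscr{A}$ is the union of all members of $\mathscr{A}$. *)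

(* Defs.v *)
From HB Require Import structures.
From mathcomp Require Import all_boot all_order all_algebra.
From mathcomp Require Import all_classical all_reals all_analysis.

Set Implicit Arguments.
Unset Strict Implicit.
Unset Printing Implicit Defensive.

Import Order.TTheory GRing.Theory Num.Theory.
Import numFieldNormedType.Exports.

Local Open Scope classical_set_scope.
Local Open Scope ring_scope.

(* R^N is 'rV[R]_N.  Its library norm is the max norm, which gives the usual
   topology and the usual notions of differentiability and of locally Lipschitz
   map; diameters are taken for the Euclidean norm defined here. *)
Definition euclidean_norm (R : realType) (N : nat) (x : 'rV[R]_N) : R :=
  Num.sqrt (\sum_(i < N) x ord0 i ^+ 2).

Section submanifolds.
Variable R : realType.

Definition homeomorphic_sets (S T : topologicalType) (A : set S) (B : set T) :=
  exists (f : S -> T) (g : T -> S),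
    [/\ set_fun A B f, set_fun B A g,
        {in A, cancel f g}, {in B, cancel g f} &
        {within A, continuous f} /\ {within B, continuous g}].

(* Hausdorffness and second countability need not be required, as they are
   inherited from R^N. *)
Definition topological_submanifold (d N : nat) (M : set 'rV[R]_N) :=
  connected M /\
  forall p, M p -> exists (U : set 'rV[R]_N) (W : set 'rV[R]_d),
    [/\ open U, U p, open W & homeomorphic_sets (M `&` U) W].

Definition rigid_motion (N : nat) (g : 'rV[R]_N -> 'rV[R]_N) :=
  exists (Q : 'M[R]_N) (v : 'rV[R]_N),
    Q *m Q^T = 1%:M /\ forall x, g x = x *m Q + v.

Definition graph_over (d k : nat) (W : set 'rV[R]_d)
    (f : 'rV[R]_d -> 'rV[R]_k) : set 'rV[R]_(d + k) :=
  [set row_mx x (f x) | x in W].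

(* [reg W f] is the regularity required of the map f on the open set W; the
   values of f outside W are irrelevant. *)
Definition locally_graph (d k : nat)
    (reg : set 'rV[R]_d -> ('rV[R]_d -> 'rV[R]_k) -> Prop)
    (M : set 'rV[R]_(d + k)) :=
  forall p, M p -> exists (U : set 'rV[R]_(d + k)) (W : set 'rV[R]_d)
      (f : 'rV[R]_d -> 'rV[R]_k) (g : 'rV[R]_(d + k) -> 'rV[R]_(d + k)),
    [/\ open U /\ U p, open W, reg W f, rigid_motion g &
        M `&` U = g @` graph_over W f].

Definition C1_on (d k : nat) (W : set 'rV[R]_d) (f : 'rV[R]_d -> 'rV[R]_k) :=
  (forall x, W x -> differentiable f x) /\
  (forall x, W x -> {for x, continuous (fun y => 'J f y)}).

Definition locally_lipschitz_diff_on (d k : nat) (W : set 'rV[R]_d)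
    (f : 'rV[R]_d -> 'rV[R]_k) :=
  forall x, W x -> exists2 V, nbhs x V & [lipschitz 'J f y | y in V].

Definition C1_submanifold (d k : nat) (M : set 'rV[R]_(d + k)) :=
  topological_submanifold d M /\ locally_graph (@C1_on d k) M.

Definition lipschitz_C1_submanifold (d k : nat) (M : set 'rV[R]_(d + k)) :=
  C1_submanifold M /\
  locally_graph
    (fun W (f : 'rV[R]_d -> 'rV[R]_k) =>
       C1_on W f /\ locally_lipschitz_diff_on W f) M.

Definition affine_subspace (d N : nat) (P : set 'rV[R]_N) :=
  exists (a : 'rV[R]_N) (V : 'M[R]_N),
    \rank V = d /\ P = [set x | (x - a <= V)%MS].

Definition hyperplane (n : nat) (P : set 'rV[R]_(n + 1)) := affine_subspace n P.

Definition linear_submanifold (N : nat) (M : set 'rV[R]_N) :=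
  exists (d : nat) (P : set 'rV[R]_N), affine_subspace d P /\
    exists2 O : set 'rV[R]_N, open O & M = P `&` O.

End submanifolds.

Section hausdorff_dimension.
Variables (R : realType) (N : nat).
Implicit Types (A : set 'rV[R]_N) (s delta : R).

Local Open Scope ereal_scope.

Definition diam A : \bar R :=
  ereal_sup [set (euclidean_norm (x - y)%R)%:E | x in A & y in A].

(* diam(A)^s, with the empty set contributing 0 (also for s = 0, where the
   convention for nonempty A is diam(A)^0 = 1). *)
Definition diam_pow s A : \bar R :=
  if A == set0 then 0 else poweR (diam A) s.

Definition hausdorff_premeasure s delta A : \bar R :=
  ereal_inf [set \sum_(0 <= i <oo) diam_pow s (U i) |
    U in [set U : nat -> set 'rV[R]_N |
          A `<=` \bigcup_i U i /\ forall i, diam (U i) <= delta%:E]].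

Definition hausdorff_measure s A : \bar R :=
  ereal_sup [set hausdorff_premeasure s delta A | delta in [set e : R | (0 < e)%R]].

Definition hausdorff_dim A : \bar R :=
  ereal_inf [set s%:E | s in [set s : R | (0 <= s)%R /\ hausdorff_measure s A = 0]].

End hausdorff_dimension.

(* Main.v *)
Require Import Defs.
From mathcomp Require Import all_boot all_order all_algebra.
From mathcomp Require Import all_classical all_reals all_analysis.
From mathcomp Require Import measurable_realfun ring lra zify.

(** Why the theorem holds.

    Every subset of R^N has Hausdorff dimension at most N ([null_setT]).  For the
    lower bound, let X be the union of the hyperplanes and suppose that X has zero
    s-dimensional measure for some s in ]n, n + 1[.  Then M is linear
    ([null_cover_linear]), for the following reasons.

    Reduction to the plane.  By connectedness M is linear as soon as it is locally
    a piece of an affine subspace ([locally_affine_linear]), so it is enough to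
    show that the function f of each chart is affine near each point x0
    ([null_cover_affine]).  Otherwise t |-> f (x0 + t e) has a nonconstant
    derivative for some direction e.  Integrating the covers of X along a
    Lipschitz functional shows that arbitrarily close to any value of the
    functional there is a value whose slice of X is null in dimension s - 1
    ([null_slice]).  Fixing in this way n - 1 coordinates transverse to e leaves a
    plane set which is null in dimension s - n + 1 < 2 and which contains a line
    through each point of the graph of phi t = f (x0 + w + t e), where w is so
    small that the derivative of phi is still nonconstant.

    The plane.  The central fact ([line_family_not_null]) is a projection theorem
    of Marstrand type: if lines are indexed by a set of reals of positive outer
    measure, and two lines are at least proportionally as far apart as their
    indices, then the union of the lines is not null in any dimension s < 2.  Its
    proof is an energy estimate, discretized: N lines with N^-1-separated indices
    are observed at N abscissae.  On the one hand the total energy of exponent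
    s - 1 of the observed ordinates is O(N^3) ([total_energy]), since two affine
    functions that differ somewhere by D differ little at few places
    ([affine_energy]); on the other hand a cover of the lines by squares with a
    small sum of s-th powers of radii forces the energy to be large
    ([classes_energy]).  The lines come from an arbitrary family, so there is no
    measurability: everything is said with outer measure, and its continuity from
    below ([outer_nondecreasing_bigcup]) gives finitely many squares that cover
    enough of the lines.

    Now let a line through each point of the graph of phi lie in a null set.
    Vertical lines occur over a null set of abscissae ([vertical_outer0]).  So do
    lines that are transverse to the graph, since these are separated when indexed
    by the abscissa ([transverse_outer0]).  Tangent lines are separated when
    indexed by their slope, so the derivative phi' maps the abscissae of tangency
    to a null set ([tangent_image_outer0]).  Since phi' is Lipschitz it also maps
    the null set of the other abscissae to a null set; this is what the Lipschitz
    condition is for.  Hence the image of phi' is null, and being an interval it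
    is a single point ([lines_derivative_constant]). *)

Set Implicit Arguments.
Unset Strict Implicit.
Unset Printing Implicit Defensive.

Import Order.TTheory GRing.Theory Num.Theory.
Import numFieldNormedType.Exports.

Local Open Scope classical_set_scope.
Local Open Scope ring_scope.

(** * Sets of zero Hausdorff measure, through covers by balls *)

Section null_sets.
Context {R : realType}.
Implicit Types (V : normedModType R) (s e : R).

(** Zero s-dimensional Hausdorff measure, with balls for covering sets.  The
    strict inequality makes the covering sets open, which is needed for
    compactness, and lets radius 0 encode an unused index. *)
Definition null V s (X : set V) := forall e, 0 < e ->
  exists (c : nat -> V) (r : nat -> R),
    [/\ forall i, 0 <= r i,
        forall m, \sum_(i < m) r i `^ s <= e &
        forall x, X x -> exists i, `|x - c i| < r i].

Lemma nullS V s (X Y : set V) : X `<=` Y -> null s Y -> null s X.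
Proof.
move=> XY nY e /nY[c [r [r0 rs cov]]]; exists c, r; split=> // x /XY; exact: cov.
Qed.

(** The Lipschitz bound holds on X only, so the centres of the new balls have to
    be images of points of X; this doubles the radii. *)
Lemma null_lipschitz_image V V' s (K : R) (f : V -> V') (X : set V) :
  0 < K -> (forall x y, X x -> X y -> `|f x - f y| <= K * `|x - y|) ->
  null s X -> null s (f @` X).
Proof.
move=> K0 fK nX e e0.
have KK0 : 0 < (2 * K) `^ s by rewrite powR_gt0// mulr_gt0.
have [c [r [r0 rs cov]]] := nX (e / (2 * K) `^ s) (divr_gt0 e0 KK0).
pose P i x := X x /\ `|x - c i| < r i.
have /choice[y Py] : forall i, exists y, (exists x, P i x) -> P i y.
  move=> i; have [[x Px]|nP] := pselect (exists x, P i x); first by exists x.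
  by exists 0 => /nP.
exists (f \o y), (fun i => 2 * K * r i); split.
- by move=> i; rewrite mulr_ge0// mulr_ge0// ltW.
- move=> m; under eq_bigr do rewrite powRM ?mulr_ge0 ?(ltW K0)//.
  by rewrite -mulr_sumr mulrC -ler_pdivlMr.
- move=> _ [x Xx <-]; have [i xi] := cov _ Xx; exists i.
  have [Xy yi] : P i (y i) by apply: Py; exists x.
  apply: (le_lt_trans (fK _ _ Xx Xy)); rewrite -mulrA mulrCA ltr_pM2l//.
  have -> : x - y i = (x - c i) - (y i - c i) by rewrite opprB addrA subrK.
  by apply: (le_lt_trans (ler_normB _ _)); rewrite mulr_natl mulr2n ltrD.
Qed.

End null_sets.

(** * Lebesgue outer measure on the line *)

Section outer.
Context {R : realType}.
Local Notation mu := (@lebesgue_measure R).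

Lemma outer_le (X Y : set R) : X `<=` Y -> (mu X <= mu Y)%E.
Proof. exact: (@le_outer_measure _ _ (wlength idfun)^*%mu). Qed.

Lemma outer_ge0 (X : set R) : (0 <= mu X)%E.
Proof. exact: (outer_measure_ge0 (wlength idfun)^*%mu). Qed.

Lemma outer_bigcup (F : nat -> set R) :
  (mu (\bigcup_i F i) <= \sum_(i <oo) mu (F i))%E.
Proof. exact: (outer_measure_sigma_subadditive (wlength idfun)^*%mu). Qed.

Lemma outer_bigcup0 (F : nat -> set R) :
  (forall i, mu (F i) = 0%E) -> mu (\bigcup_i F i) = 0%E.
Proof.
move=> F0; apply/eqP; rewrite eq_le outer_ge0 andbT.
by apply: (le_trans (outer_bigcup F)); rewrite eseries0.
Qed.

Lemma outerU (X Y : set R) : (mu (X `|` Y) <= mu X + mu Y)%E.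
Proof. exact: (outer_measureU2 (wlength idfun)^*%mu). Qed.

Lemma outerU0 (X Y : set R) : mu X = 0%E -> mu Y = 0%E -> mu (X `|` Y) = 0%E.
Proof.
move=> X0 Y0; apply/eqP; rewrite eq_le outer_ge0 andbT.
by apply: (le_trans (outerU X Y)); rewrite X0 Y0 adde0.
Qed.

Lemma outer_hull (X : set R) : exists G : set R,
  [/\ measurable G, X `<=` G & mu G = mu X].
Proof.
have [G [oG XG GX]] := outer_measure_Gdelta X; exists (\bigcap_i G i); split=> //.
by apply: bigcapT_measurable => i; exact: open_measurable.
Qed.

(** Continuity from below holds for all sets, measurable or not, because each set
    has a measurable hull of the same measure; the tail intersections of the hulls
    form a nondecreasing sequence. *)
Lemma outer_nondecreasing_bigcup (F : nat -> set R) (c : R) :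
  nondecreasing_seq F -> (c%:E < mu (\bigcup_i F i))%E ->
  exists i, (c%:E < mu (F i))%E.
Proof.
move=> ndF cF; apply: contrapT => /forallNP Fc.
have {}Fc i : (mu (F i) <= c%:E)%E by rewrite leNgt; apply/negP.
have /choice[G Gp] := fun i => outer_hull (F i).
pose H m := \bigcap_(k in [set k | (m <= k)%N]) G k.
have mH m : measurable (H m).
  by apply: bigcap_measurable => [|k _]; [exists m => /=|case: (Gp k)].
have ndH : nondecreasing_seq H.
  move=> m n mn; apply/subsetPset => x Hx k /= nk; apply: Hx => /=.
  exact: leq_trans nk.
have FH i : F i `<=` H i.
  move=> x Fx k /= ik; have [_ + _] := Gp k; apply.
  by have /subsetPset := ndF _ _ ik; exact.
have Hc i : (mu (H i) <= c%:E)%E.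
  apply: (le_trans _ (Fc i)); have [_ _ <-] := Gp i.
  by apply: outer_le => x; apply => /=.
have := nondecreasing_cvg_mu (mu := mu) mH (bigcup_measurable (fun i _ => mH i)) ndH.
move/(cvg_lim (@ereal_hausdorff R)) => Hlim.
have : (mu (\bigcup_i F i) <= c%:E)%E.
  apply: (@le_trans _ _ (mu (\bigcup_i H i))).
    by apply: outer_le; apply: subset_bigcup => i _; exact: FH.
  rewrite -Hlim; apply: lime_le; last by apply: nearW => i /=; exact: Hc.
  apply: ereal_nondecreasing_is_cvgn => i j ij /=; apply: outer_le.
  by apply/subsetPset; exact: ndH.
by rewrite leNgt cF.
Qed.

(** Radii below 1 only decrease when the exponent goes from s up to 1. *)
Lemma null_outer0 (s : R) (X : set R) : 0 < s <= 1 -> null s X -> mu X = 0%E.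
Proof.
move=> /andP[s0 s1] nX; apply/eqP; rewrite eq_le outer_ge0 andbT.
apply/lee_addgt0Pr => e e0; rewrite add0e.
pose d := Num.min 1 (e / 2).
have d0 : 0 < d by rewrite lt_min ltr01 divr_gt0.
have [c [r [r0 rs cov]]] := nX _ d0.
have ri1 i : r i `^ s <= d.
  apply: le_trans (rs i.+1); rewrite big_ord_recr/= lerDr.
  by apply: sumr_ge0 => ? _; rewrite powR_ge0.
have rle i : r i <= r i `^ s.
  have [->|rn0] := eqVneq (r i) 0; first exact: powR_ge0.
  have rp : 0 < r i by rewrite lt_neqAle eq_sym rn0 r0.
  apply: ger1_powR => //; rewrite rp/= leNgt; apply/negP => r1.
  have := ri1 i; rewrite leNgt => /negP; apply.
  apply: (@le_lt_trans _ _ 1); first by rewrite /d ge_min lexx.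
  have := @gt0_ltr_powR R s s0 1 (r i); rewrite powR1; apply => //; rewrite nnegrE// ltW.
apply: (@le_trans _ _ (\sum_(i <oo) mu (ball (c i) (r i)))%E).
  apply: le_trans (outer_bigcup _); apply: outer_le => x /cov[i xi].
  by exists i => //; rewrite -ball_normE /ball_/= distrC.
apply: lime_le.
  by apply: is_cvg_nneseries => *; exact: outer_ge0.
apply: nearW => m /=.
rewrite big_mkord (eq_bigr (fun i : 'I_m => (r i *+ 2)%:E)); last first.
  by move=> i _; exact: lebesgue_measure_ball.
rewrite sumEFin lee_fin sumrMnl mulr2n.
have le1 : \sum_(i < m) r i <= e / 2.
  apply: (@le_trans _ _ d); last by rewrite /d ge_min lexx orbT.
  by apply: (le_trans _ (rs m)); apply: ler_sum => i _; exact: rle.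
by rewrite [leRHS]splitr lerD.
Qed.

(** An interval is a ball, and the outer measure is computed by covers by open
    intervals. *)
Lemma outer0_null (X : set R) : mu X = 0%E -> null 1 X.
Proof.
move=> X0 e e0; have : (ereal_inf [set \sum_(k <oo) wlength idfun (F k) | F in open_itv_cover X] < e%:E)%E.
  by rewrite -outer_measure_open_itv_cover (_ : _ X = 0%E) ?lte_fin//; exact: X0.
move=> /ereal_inf_lt[_ [F [Fitv XF] <-]] Fe.
have /choice[ab abP] : forall i, exists ab : R * R, F i = `]ab.1, ab.2[%classic.
  by move=> i; have [ab Fi] := Fitv i; exists ab.
pose r i := if (ab i).1 < (ab i).2 then ((ab i).2 - (ab i).1) / 2 else 0.
have r0 i : 0 <= r i.
  by rewrite /r; case: ifPn => // h; rewrite divr_ge0// subr_ge0 ltW.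
have lenF i : (wlength idfun (F i) = (r i *+ 2)%:E)%E.
  rewrite abP wlength_itv/= lte_fin /r; case: ifPn => // h.
    by rewrite -EFinB mulr2n -splitr.
  by rewrite mul0rn.
exists (fun i => ((ab i).1 + (ab i).2) / 2), r; split => //.
- move=> m; under eq_bigr do rewrite powRr1//.
  apply: (@le_trans _ _ (\sum_(i < m) r i *+ 2)).
    by apply: ler_sum => i _; rewrite mulr2n lerDr.
  rewrite -lee_fin -sumEFin; apply: le_trans (ltW Fe).
  under eq_bigr do rewrite -lenF; rewrite -(big_mkord xpredT (fun i => wlength idfun (F i))).
  apply: nneseries_lim_ge => i _ _; rewrite lenF lee_fin mulrn_wge0//.
- move=> x /XF[i _]; rewrite abP/= in_itv/= => /andP[ax xb]; exists i.
  rewrite /r (lt_trans ax xb) ltr_norml; apply/andP; split; lra.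
Qed.

Lemma outer0_lipschitz_image (K : R) (f : R -> R) (X : set R) :
  0 < K -> (forall x y, X x -> X y -> `|f x - f y| <= K * `|x - y|) ->
  mu X = 0%E -> mu (f @` X) = 0%E.
Proof.
move=> K0 fK /outer0_null nX; apply: (@null_outer0 1); first by rewrite ltr01 lexx.
exact: (null_lipschitz_image K0 fK nX).
Qed.

(** Greedy choice from the left: each chosen point, taken within d of the infimum
    of what is left, uses up an interval of length 2 d. *)
Lemma outer_spread (d : R) (N : nat) (X : set R) : 0 < d -> has_lbound X ->
  ((2 * d *+ N)%:E < mu X)%E ->
  exists x : nat -> R, (forall k, (k < N)%N -> X (x k)) /\
    (forall k l, (k <= l < N)%N -> d *+ (l - k) <= x l - x k).
Proof.
move=> d0; elim: N X => [|N IH] X lbX muX.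
  by exists (fun=> 0); split=> // k l; rewrite ltn0 andbF.
have X0 : X !=set0.
  apply/set0P/eqP => X0; move: muX; rewrite X0 measure0 lte_fin ltNge.
  by rewrite mulrn_wge0// mulr_ge0// ltW.
have [x0 Xx0 x0i] : exists2 x0, X x0 & x0 < inf X + d.
  by apply: inf_adherent.
have iX : forall x, X x -> inf X <= x by move=> x Xx; apply: ge_inf.
pose Y := X `&` [set x | x0 + d <= x].
have XY : X `<=` Y `|` `[inf X, inf X + 2 * d]%classic.
  move=> x Xx; have [?|/ltW xd] := leP (x0 + d) x; [by left; split|right].
  by rewrite /= in_itv/= iX//= mulr_natl mulr2n addrA (le_trans xd)// lerD2r ltW.
have muY : ((2 * d *+ N)%:E < mu Y)%E.
  have := lt_le_trans muX (le_trans (outer_le XY) (outerU _ _)).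
  rewrite lebesgue_measure_itv/= lte_fin ltrDl mulr_gt0// -EFinB addrAC subrr add0r.
  by rewrite mulrS addrC EFinD lteD2rE.
have lbY : has_lbound Y by case: lbX => b Xb; exists b => x [/Xb].
have [x [Yx xsep]] := IH Y lbY muY.
exists (fun k => if k is k'.+1 then x k' else x0); split.
  by case=> // k kN; have [] := Yx k kN.
case=> [|k] [|l]; rewrite ?subn0 ?subrr//.
- move=> /= lN; have [_ /= xl] := Yx 0%N (leq_ltn_trans (leq0n l) lN).
  have := xsep 0%N l; rewrite leq0n/= subn0 => /(_ lN); rewrite mulrS => xl0.
  by rewrite -(subrK (x 0%N) (x l)) -addrA addrC lerD// lerBrDl.
- by rewrite subSS ltnS => kl; apply: xsep.
Qed.

End outer.

(** * Slices of null sets *)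

Section slicing.
Context {R : realType}.
Local Notation mu := (@lebesgue_measure R).

(** A sum of weighted indicators of intervals cannot exceed 1 on all of ]a, b[ if
    its integral is less than b - a. *)
Lemma exists_small_superposition (a b : R) (w rho c : nat -> nat -> R) : a < b ->
  (forall j i, 0 <= w j i) -> (forall j i, 0 <= rho j i) ->
  (\sum_(j <oo) \sum_(i <oo) (w j i * (rho j i *+ 2))%:E < (b - a)%:E)%E ->
  exists2 t, a < t < b &
    (\sum_(j <oo) \sum_(i <oo) (w j i * \1_(ball (c j i) (rho j i)) t)%:E <= 1)%E.
Proof.
move=> ab w0 rho0 small; apply: contrapT => noT.
pose f j i (t : R) := (w j i * \1_(ball (c j i) (rho j i)) t)%:E.
pose D : set R := `]a, b[%classic.
have mD : measurable D by exact: measurable_itv.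
have f0 j i t : (0 <= f j i t)%E.
  by rewrite lee_fin mulr_ge0// indicE.
have mf j i : measurable_fun D (f j i).
  apply/measurable_EFinP/measurable_funM => //.
  apply: measurable_indic; exact: measurable_ball.
have mF j : measurable_fun D (fun t => \sum_(i <oo) f j i t)%E.
  by apply: ge0_emeasurable_sum => //.
have mG : measurable_fun D (fun t => \sum_(j <oo) \sum_(i <oo) f j i t)%E.
  apply: (ge0_emeasurable_sum (P := xpredT) (h := fun j t => (\sum_(i <oo) f j i t)%E)) => //.
  by move=> j t _ _; exact: nneseries_ge0.
have muD : mu D = (b - a)%:E by rewrite /D lebesgue_measure_itv/= lte_fin ab.
have : (mu D <= \int[mu]_(t in D) \sum_(j <oo) \sum_(i <oo) f j i t)%E.
  rewrite -[leLHS]mul1e -integral_cst//; apply: ge0_le_integral => //.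
  - move=> t; rewrite /D/= in_itv/= => abt; apply: ltW; rewrite ltNge.
    by apply/negP => tle; apply: noT; exists t.
rewrite integral_nneseries//; last by move=> j t _; apply: nneseries_ge0.
rewrite (_ : (\sum_(_ <oo) _)%E = \sum_(j <oo) \sum_(i <oo) \int[mu]_(t in D) f j i t)%E; last first.
  by apply: eq_eseriesr => j _; apply: integral_nneseries => [//|i|i t _]; [exact: mf|exact: f0].
rewrite muD; apply/negP; rewrite -ltNge; apply: le_lt_trans small.
apply: lee_nneseries => [j _ _|j _]; first by apply: nneseries_ge0 => i _ _; exact: integral_ge0.
apply: lee_nneseries => [i _ _|i _]; first exact: integral_ge0.
rewrite /f; under eq_integral do rewrite EFinM.
rewrite ge0_integralZl_EFin//; last by apply/measurable_EFinP/measurable_indic; exact: measurable_ball.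
rewrite EFinM lee_wpmul2l ?lee_fin// integral_indic//; last exact: measurable_ball.
by rewrite -(lebesgue_measure_ball (c j i))//; apply: outer_le; exact: subIsetl.
Qed.


Lemma ler_nneseries_term (u : nat -> \bar R) j : (forall i, 0 <= u i)%E ->
  (u j <= \sum_(i <oo) u i)%E.
Proof.
move=> u0; apply: (@le_trans _ _ (\sum_(0 <= i < j.+1) u i)%E).
  by rewrite big_nat_recr//= leeDr// sume_ge0.
exact: nneseries_lim_ge.
Qed.

(** A ball of radius r meets only the slices over an interval of length
    proportional to r, so the integral over t of the sum of r^(s - 1), over the
    balls that meet the slice at t, is at most a multiple of the sum of r^s. *)
Lemma null_slice (V : normedModType R) (s K : R) (lam : V -> R) (X : set V) (a b : R) :
  0 < K -> (forall x y, `|lam x - lam y| <= K * `|x - y|) -> a < b -> 1 < s ->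
  null s X -> exists2 t, a < t < b & null (s - 1) (X `&` lam @^-1` [set t]).
Proof.
move=> K0 lamK ab s1 nX.
have s0 : 0 < s by apply: lt_trans s1.
(* The j-th cover is weighted by 2^j, so that one value t makes all of its sums at
   most 2^(- j); the sum over j of the weighted integrals is still below b - a. *)
pose e j : R := (b - a) / 2 / (2 ^ j.+1)%:R / 2 ^+ j / (2 * K).
have e0 j : 0 < e j.
  by rewrite !divr_gt0 ?subr_gt0 ?exprn_gt0 ?mulr_gt0// ltr0n expn_gt0.
have /choice[c cP] := fun j => nX _ (e0 j).
have /choice[r rP] := cP.
have r0 j i : 0 <= r j i by have [] := rP j.
pose w j i := 2 ^+ j * r j i `^ (s - 1).
have w0 j i : 0 <= w j i by rewrite mulr_ge0 ?powR_ge0// exprn_ge0.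
have [||t abt tw] := @exists_small_superposition a b w (fun j i => K * r j i)
    (fun j i => lam (c j i)) ab w0.
- by move=> j i; rewrite mulr_ge0// ltW.
- apply: (@le_lt_trans _ _ (\sum_(j <oo) ((b - a) / 2 / (2 ^ j.+1)%:R)%:E)%E).
    apply: lee_nneseries => [j _ _|j _].
      by apply: nneseries_ge0 => i _ _; rewrite lee_fin mulr_ge0// mulrn_wge0// mulr_ge0// ltW.
    apply: lime_le.
      by apply: is_cvg_nneseries => i _ _; rewrite lee_fin mulr_ge0// mulrn_wge0// mulr_ge0// ltW.
    apply: nearW => m; rewrite big_mkord sumEFin lee_fin.
    have [_ rs _] := rP j.
    rewrite (eq_bigr (fun i : 'I_m => 2 ^+ j * (2 * K) * r j i `^ s)); last first.
      move=> i _; rewrite -(mulr_powRB1 (r0 j i) s0) /w; ring.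
    rewrite -mulr_sumr mulrC -ler_pdivlMr ?mulr_gt0 ?exprn_gt0//.
    by apply: (le_trans (rs m)); rewrite /e -mulrA -invfM.
  apply: (le_lt_trans (@epsilon_trick0 R ((b - a) / 2) xpredT _)).
    by rewrite divr_ge0// subr_ge0 ltW.
  by rewrite lte_fin ltr_pdivrMr// ltr_pMr ?subr_gt0// ltr1n.
exists t => // d d0.
have [j jd] : exists j, (2 ^+ j)^-1 <= d.
  have [j _ /(_ j (leqnn _)) jd] := near_infty_natSinv_expn_lt (PosNum d0).
  by exists j; move: jd; rewrite div1r => /ltW.
(* Only the balls that can meet the slice are kept. *)
exists (c j), (fun i => if `|t - lam (c j i)| < K * r j i then r j i else 0); split.
- by move=> i; case: ifP.
- move=> m; apply: (le_trans _ jd).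
  rewrite -[leRHS]mul1r ler_pdivlMr ?exprn_gt0// mulrC mulr_sumr -lee_fin.
  apply: le_trans tw.
  apply: le_trans (ler_nneseries_term j _); last first.
    by move=> i; apply: nneseries_ge0 => k _ _; rewrite lee_fin mulr_ge0// indicE.
  apply: le_trans (nneseries_lim_ge m _); last first.
    by move=> i _ _; rewrite lee_fin mulr_ge0// indicE.
  rewrite big_mkord sumEFin lee_fin; apply: ler_sum => i _.
  rewrite indicE; case: ifPn => h.
    by rewrite mem_set ?mulr1// /ball/= distrC.
  rewrite powR0; last by rewrite gt_eqF// subr_gt0.
  by rewrite mulr0 mulr_ge0//.
- move=> x [Xx /= xt]; have [_ _ cov] := rP j; have [i xi] := cov _ Xx.
  exists i; rewrite ifT// -xt; apply: (le_lt_trans (lamK _ _)).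
  by rewrite ltr_pM2l.
Qed.

End slicing.

(** * Sums of negative powers *)

Section powersums.
Context {R : realType}.
Implicit Types (s : R).

(** The concave function x^p lies below its tangent at x + 1; this is the weighted
    inequality between arithmetic and geometric means. *)
Lemma powR_tangent (p x : R) : 0 < p < 1 -> 0 <= x ->
  x `^ p <= (x + 1) `^ p - p * (x + 1) `^ (p - 1).
Proof.
move=> /andP[p0 p1] x0; set y := x + 1.
have y0 : 0 < y by rewrite /y ltr_wpDl.
have := @conjugate_powR R (x `^ p) (y `^ (1 - p)) p^-1 (1 - p)^-1.
rewrite -!powRrM !invrK !mulfV ?gt_eqF ?subr_gt0// !powRr1 ?(ltW y0)//.
rewrite !powR_ge0 !invr_gt0 subr_gt0 p0 p1 subrKC => /(_ isT isT isT isT erefl).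
have -> : x * p + y * (1 - p) = y - p by rewrite /y; ring.
have yp : 0 < y `^ (p - 1) by rewrite powR_gt0.
rewrite -(ler_pM2r yp) -mulrA -powRD; last by rewrite (gt_eqF y0) implybT.
rewrite addrA subrK subrr powRr0 mulr1 => /le_trans; apply.
rewrite mulrBl; rewrite lerB// -[X in X * _](powRr1 (ltW y0)) -powRD ?subrKC//.
by rewrite (gt_eqF y0) implybT.
Qed.

(** Comparison with the integral of x^(- s), one tangent at a time. *)
Lemma sum_powRN s N : 0 < s < 1 ->
  \sum_(i < N) i.+1%:R `^ (- s) <= N%:R `^ (1 - s) / (1 - s).
Proof.
move=> /andP[s0 s1]; have s10 : 0 < 1 - s by rewrite subr_gt0.
elim: N => [|N IH].
  by rewrite big_ord0 divr_ge0 ?powR_ge0// ltW.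
rewrite big_ord_recr/=; apply: (le_trans (lerD IH (lexx _))).
rewrite ler_pdivlMr// mulrDl divfK ?gt_eqF//.
have := @powR_tangent (1 - s) N%:R; rewrite s10 gtrBl s0 => /(_ isT (ler0n _ _)).
rewrite natr1 addrAC subrr add0r lerBrDr; lra.
Qed.

Definition dist (j k : nat) := ((j - k) + (k - j))%N.

Lemma distE j k : `|j%:R - k%:R : R| = (dist j k)%:R.
Proof.
rewrite /dist; case: (leqP j k) => [jk|/ltnW kj].
  by rewrite distrC -natrB// normr_nat (eqP jk) add0n.
by rewrite -natrB// normr_nat (eqP kj) addn0.
Qed.

Lemma dist_gt0 (j k : nat) : j != k -> (0 < dist j k)%N.
Proof. by rewrite /dist addn_gt0 !subn_gt0 neq_ltn orbC. Qed.

Lemma distC j k : dist j k = dist k j. Proof. by rewrite /dist addnC. Qed.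

(** Each positive distance to k is attained at most twice. *)
Lemma sum_dist_le (g : nat -> R) N k : (forall i, 0 <= g i) -> (k < N)%N ->
  \sum_(j < N | j != k :> nat) g (dist j k) <= 2 * \sum_(i < N) g i.+1.
Proof.
move=> g0 kN; rewrite -(big_mkord (fun j => j != k) (fun j => g (dist j k))).
rewrite (big_cat_nat (n := k))//=; last exact: ltnW.
rewrite mulr_natl mulr2n lerD//.
  rewrite big_nat_rev/= add0n big_nat_cond.
  apply: (@le_trans _ _ (\sum_(0 <= i < k) g i.+1)).
    rewrite [leRHS]big_nat_cond [leLHS]big_mkcond [leRHS]big_mkcond/=.
    apply: ler_sum => i _; rewrite andbT.
    case: (boolP (i < k)%N) => [ik|]; rewrite ?andbF//=.
    case: ifP => _; last exact: g0.
    by rewrite /dist (_ : (_ + _)%N = i.+1)//; lia.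
  rewrite -(big_mkord xpredT (fun i => g i.+1)).
  by rewrite [leRHS](big_cat_nat (n := k))//=; [rewrite lerDl sumr_ge0|exact: ltnW].
rewrite big_ltn_cond// eqxx/=.
rewrite (big_addn 0 N k.+1) -(big_mkord xpredT (fun i => g i.+1)).
apply: (@le_trans _ _ (\sum_(0 <= i < N - k.+1) g i.+1)).
  rewrite [leLHS]big_mkcond; apply: ler_sum => i _; case: ifP => _; last exact: g0.
  by rewrite /dist (_ : (_ - k + _)%N = i.+1)//; lia.
by rewrite [leRHS](big_cat_nat (n := N - k.+1))//=; [rewrite lerDl sumr_ge0|exact: leq_subr].
Qed.

Lemma sum_dist_powRN s N k : 0 < s < 1 -> (k < N)%N ->
  \sum_(j < N | j != k :> nat) (dist j k)%:R `^ (- s) <=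
    2 * (N%:R `^ (1 - s) / (1 - s)).
Proof.
move=> s01 kN; apply: (le_trans (@sum_dist_le (fun d => d%:R `^ (- s)) N k _ kN)).
  by move=> i; exact: powR_ge0.
by rewrite ler_pM2l//; exact: sum_powRN.
Qed.

(** All indices that satisfy P lie between the first and the last of them. *)
Lemma sum_narrow_le (P : pred nat) (B : R) N : 0 <= B ->
  (forall i j, (i <= j)%N -> P i -> P j -> (j - i)%:R <= B) ->
  \sum_(j < N) (P j)%:R <= B + 1.
Proof.
move=> B0 PB.
have : (forall j, (j < N)%N -> ~~ P j) \/ exists i j, [/\ (i <= j < N)%N, P i, P j &
    \sum_(j < N) (P j)%:R <= (j - i)%:R + 1 :> R].
  elim: N => [|N [no|[i [j [/andP[ij jN] Pi Pj le]]]]]; first by left.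
  - case: (boolP (P N)) => PN.
      right; exists N, N; rewrite leqnn ltnSn; split=> //.
      rewrite big_ord_recr/= PN subnn add0r big1 ?add0r// => i _.
      by rewrite (negPf (no _ (ltn_ord i))).
    left=> j; rewrite ltnS leq_eqVlt => /predU1P[->//|]; exact: no.
  - right; rewrite big_ord_recr/=; case: (boolP (P N)) => PN.
      exists i, N; rewrite ltnSn (leq_trans ij (ltnW jN)); split=> //.
      rewrite lerD// (le_trans le)// natr1 ler_nat -subSn//.
      exact: leq_sub2r.
    by exists i, j; rewrite ij (leqW jN)//= addr0.
case=> [no|[i [j [/andP[ij _] Pi Pj le]]]].
  rewrite big1 ?addr_ge0// => i _; by rewrite (negPf (no _ (ltn_ord i))).
by apply: (le_trans le); rewrite lerD2r PB.
Qed.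

End powersums.

(** * Discrete energies *)

Section energy.
Context {R : realType}.
Implicit Types (s : R).

Lemma ler_powRN s (x y : R) : 0 <= s -> 0 < x -> x <= y -> y `^ (- s) <= x `^ (- s).
Proof.
move=> s0 x0 xy; have y0 : 0 < y by apply: lt_le_trans xy.
rewrite !powRN lef_pV2 ?posrE ?powR_gt0//.
by apply: ge0_ler_powR => //; rewrite nnegrE ltW.
Qed.

(** The energy of the difference u + A j of two lines seen at the abscissae
    j = 0, ..., N - 1, truncated at d, when that difference reaches D somewhere on
    [0, N].  Either all values are at least D / 2, or the slope is at least
    D / (2 N); in the latter case the j-th value is bounded below in terms of the
    distance from j to the index where the value is smallest. *)
Lemma affine_energy s (N : nat) (d D u A tau : R) : 0 < s < 1 -> 0 < d -> 0 < D ->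
  0 <= tau <= N%:R -> D <= `|u + A * tau| ->
  \sum_(j < N) Num.max (`|u + A * j%:R| / 2) d `^ (- s) <=
    d `^ (- s) + 2 * N%:R * (D / 8) `^ (- s) / (1 - s).
Proof.
move=> s01 d0 D0 /andP[tau0 tauN] Dtau; have /andP[s0 s1] := s01.
have s10 : 0 < 1 - s by rewrite subr_gt0.
pose g j := u + A * j%:R.
have maxd x : 0 < Num.max x d by rewrite lt_max d0 orbT.
have D80 : 0 < D / 8 by rewrite divr_gt0.
case: N tauN => [|N] tauN.
  by rewrite big_ord0 mulr0 !mul0r addr0 powR_ge0.
have [[j1 gj1]|gbig] := pselect (exists j : 'I_N.+1, `|g j| < D / 2); last first.
  apply: ler_wpDl; first exact: powR_ge0.
  apply: (@le_trans _ _ (\sum_(j < N.+1) (D / 8) `^ (- s))).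
    apply: ler_sum => j _; apply: ler_powRN => //; first exact: ltW.
    have /negP : ~ `|g j| < D / 2 by move=> h; apply: gbig; exists j.
    by rewrite -leNgt le_max => gj; apply/orP; left; rewrite -/(g j); lra.
  rewrite sumr_const card_ord -[leLHS]mulr_natl.
  set Q := _ `^ _; have Q0 : 0 <= Q by rewrite powR_ge0.
  have -> : 2 * N.+1%:R * Q / (1 - s) = (N.+1%:R * Q) * (2 / (1 - s)) by ring.
  by rewrite ler_peMr ?mulr_ge0// ler_pdivlMr//; lra.
have AN : D / 2 <= `|A| * N.+1%:R.
  have j1N : (j1%:R : R) <= N.+1%:R by rewrite ler_nat ltnW.
  have j10 : 0 <= (j1%:R : R) by [].
  have : `|A * (tau - j1%:R)| <= `|A| * N.+1%:R.
    rewrite normrM ler_wpM2l// ler_norml; apply/andP; split; lra.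
  have : `|u + A * tau| <= `|g j1| + `|A * (tau - j1%:R)|.
    apply: le_trans (ler_normD _ _); rewrite /g le_eqVlt; apply/orP; left.
    by apply/eqP; congr `|_|; ring.
  lra.
case: (@arg_minP _ _ _ j1 xpredT (fun j : 'I_N.+1 => `|g j|) isT) => j0 _ j0min.
have gj (j : 'I_N.+1) : `|A| * (dist j j0)%:R / 4 <= `|g j| / 2.
  have : `|A * (j%:R - j0%:R)| <= `|g j| + `|g j0|.
    apply: le_trans (ler_normB _ _); rewrite /g le_eqVlt; apply/orP; left.
    by apply/eqP; congr `|_|; ring.
  rewrite normrM distE; have := j0min j isT; lra.
rewrite (bigD1 j0)//= lerD//.
  by apply: ler_powRN => //; [exact: ltW|rewrite le_max lexx orbT].
set Q := (D / 8) `^ (- s); have Q0 : 0 <= Q by rewrite powR_ge0.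
apply: (@le_trans _ _ (\sum_(j < N.+1 | j != j0 :> nat)
    (Q * N.+1%:R `^ s) * (dist j j0)%:R `^ (- s))).
  apply: ler_sum => j jj0.
  have dj : (0 < dist j j0)%N. by exact: dist_gt0.
  have dj0 : 0 < (dist j j0)%:R :> R by rewrite ltr0n.
  have -> : Q * N.+1%:R `^ s * (dist j j0)%:R `^ (- s) =
      ((D / 8) * (N.+1%:R^-1 * (dist j j0)%:R)) `^ (- s).
    have h1 : 0 <= N.+1%:R^-1 :> R by [].
    rewrite (powRM _ (ltW D80) (mulr_ge0 h1 (ltW dj0))) (powRM _ h1 (ltW dj0)).
    rewrite -mulrA; congr (_ * (_ * _)).
    by rewrite -powR_inv1// -powRrM mulrNN mul1r.
  apply: ler_powRN; [exact: ltW|by rewrite !mulr_gt0|].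
  rewrite le_max; apply/orP; left; apply: le_trans (gj j).
  have -> : D / 8 * (N.+1%:R^-1 * (dist j j0)%:R) =
    (D / 2 / N.+1%:R) * (dist j j0)%:R / 4 by field.
  by rewrite ler_pM2r// ler_pM2r// ler_pdivrMr.
rewrite -mulr_sumr; apply: (@le_trans _ _ (Q * N.+1%:R `^ s * (2 * (N.+1%:R `^ (1 - s) / (1 - s))))).
  by rewrite ler_wpM2l ?mulr_ge0 ?powR_ge0// sum_dist_powRN.
have NN : N.+1%:R `^ s * N.+1%:R `^ (1 - s) = N.+1%:R :> R.
  by rewrite -powRD ?subrKC ?powRr1// oner_eq0.
rewrite -[in leRHS]NN le_eqVlt; apply/orP; left; apply/eqP; ring.
Qed.

Lemma sum_ord_const N (x : R) : \sum_(j < N) x = N%:R * x.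
Proof. by rewrite sumr_const card_ord mulr_natl. Qed.

(** The first term accounts for the diagonal pairs and the truncation, the second
    for the pairs of distinct lines. *)
Definition energy_const s (c kap : R) : R :=
  2 * (c / 2) `^ (- s) + 4 * (kap / 8) `^ (- s) / (1 - s) ^+ 2.

Lemma powR_divNn s (x : R) (N : nat) : 0 <= x ->
  (x / N%:R) `^ (- s) = x `^ (- s) * N%:R `^ s.
Proof.
by move=> x0; rewrite powRM// -powR_inv1// -powRrM mulrNN mul1r.
Qed.

(** For each of the N lines, the other lines at index distance i contribute
    N (i / N)^(- s), and these contributions sum to O(N^2) because s < 1.  The
    truncation at a multiple of 1 / N costs O(N^s) per pair, which is O(N). *)
Lemma total_energy s (N : nat) (c kap : R) (u A : nat -> nat -> R) :
  0 < s < 1 -> (0 < N)%N -> 0 < c -> 0 < kap ->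
  (forall k l, (k < N)%N -> (l < N)%N -> k != l -> exists2 tau : R,
     0 <= tau <= N%:R & kap * (dist k l)%:R / N%:R <= `|u k l + A k l * tau|) ->
  \sum_(k < N) \sum_(l < N) \sum_(j < N)
    Num.max (`|u k l + A k l * j%:R| / 2) (c / 2 / N%:R) `^ (- s) <=
  energy_const s c kap * N%:R ^+ 3.
Proof.
move=> s01 N0 c0 kap0 sep; have /andP[s0 s1] := s01.
have s10 : 0 < 1 - s by rewrite subr_gt0.
have NR : 0 < N%:R :> R by rewrite ltr0n.
set d := c / 2 / N%:R; have d0 : 0 < d by rewrite !divr_gt0.
set P := (kap / 8) `^ (- s); have P0 : 0 <= P by rewrite powR_ge0.
pose E := 2 * N%:R / (1 - s) * P * N%:R `^ s.
have E0 : 0 <= E by rewrite !mulr_ge0 ?powR_ge0// invr_ge0 ltW.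
have dN : d `^ (- s) <= (c / 2) `^ (- s) * N%:R.
  rewrite /d powR_divNn ?divr_ge0 ?(ltW c0)//.
  rewrite ler_wpM2l ?powR_ge0//; apply: ler1_powR; last exact: ltW.
  by rewrite ler1n.
have row k : (k < N)%N -> \sum_(l < N) \sum_(j < N)
    Num.max (`|u k l + A k l * j%:R| / 2) d `^ (- s) <= energy_const s c kap * N%:R ^+ 2.
  move=> kN; rewrite (bigD1 (Ordinal kN))//=.
  apply: (@le_trans _ _ (N%:R * d `^ (- s) + \sum_(l < N | l != k :> nat)
     (d `^ (- s) + E * (dist l k)%:R `^ (- s)))).
    apply: lerD.
      rewrite -sum_ord_const; apply: ler_sum => j _.
      by apply: ler_powRN; [exact: ltW|exact: d0|rewrite le_max lexx orbT].
    apply: ler_sum => l lk; have kl : k != l by rewrite eq_sym; exact: lk.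
    have [tau tauN Dtau] := sep k l kN (ltn_ord l) kl.
    have dl : (0 < dist k l)%N. by exact: dist_gt0.
    have dl0 : 0 < (dist k l)%:R :> R by rewrite ltr0n.
    have D0 : 0 < kap * (dist k l)%:R / N%:R by rewrite divr_gt0 ?mulr_gt0.
    apply: (le_trans (affine_energy s01 d0 D0 tauN Dtau)).
    rewrite lerD2l le_eqVlt; apply/orP; left; apply/eqP.
    have -> : kap * (dist k l)%:R / N%:R / 8 = (kap / 8 * (dist k l)%:R) / N%:R by ring.
    rewrite powR_divNn ?mulr_ge0 ?divr_ge0 ?(ltW kap0)//.
    rewrite powRM ?divr_ge0 ?(ltW kap0)// -/P (distC l k) /E; ring.
  rewrite big_split/= -mulr_sumr.
  apply: (@le_trans _ _ (N%:R * d `^ (- s) + (N%:R * d `^ (- s) +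
      E * (2 * (N%:R `^ (1 - s) / (1 - s)))))).
    rewrite lerD2l lerD//; last by rewrite ler_wpM2l// sum_dist_powRN.
    rewrite -sum_ord_const [leLHS]big_mkcond; apply: ler_sum => i _.
    by case: ifP => // _; rewrite powR_ge0.
  have NN : N%:R `^ s * N%:R `^ (1 - s) = N%:R :> R.
    by rewrite -powRD ?subrKC ?powRr1// oner_eq0.
  have -> : E * (2 * (N%:R `^ (1 - s) / (1 - s))) = 4 * P / (1 - s) ^+ 2 * N%:R ^+ 2.
    rewrite /E -exprVn [in RHS]expr2 -[X in _ = _ * (X * _)]NN; ring.
  have : N%:R * d `^ (- s) <= (c / 2) `^ (- s) * N%:R ^+ 2.
    by rewrite expr2 mulrCA ler_pM2l.
  rewrite /energy_const -/P mulrDl; lra.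
rewrite [in leRHS]exprS mulrCA -sum_ord_const.
by apply: ler_sum => k _; exact: row.
Qed.

(** N objects are put into classes of weights w.  By the inequality
    n <= (T w + n^2 / (T w)) / 2 for the number n of members of a class, and since
    the n^2 pairs of members contribute at least 1 / w each to the energy, few
    classes of small weight force a large energy. *)
Lemma classes_energy (N m : nat) (iota : 'I_N -> 'I_m) (P : pred 'I_m)
    (w : 'I_m -> R) (psi : 'I_N -> 'I_N -> R) (T : R) :
  0 < T -> (forall k, P (iota k)) -> (forall i, P i -> 0 < w i) ->
  (forall k l, 0 <= psi k l) ->
  (forall k l, iota k = iota l -> (w (iota k))^-1 <= psi k l) ->
  N%:R <= (T * \sum_(i | P i) w i + T^-1 * \sum_(k < N) \sum_(l < N) psi k l) / 2.
Proof.
move=> T0 Pi w0 psi0 psiw.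
pose n i : R := \sum_(k < N) (iota k == i)%:R.
have Nn : N%:R = \sum_(i | P i) n i.
  rewrite exchange_big/= -[LHS]mulr1 -sum_ord_const; apply: eq_bigr => k _.
  rewrite (bigD1 (iota k))//= eqxx big1 ?addr0// => i /andP[_].
  by rewrite eq_sym => /negPf ->.
have nw : \sum_(i | P i) n i ^+ 2 / w i <= \sum_(k < N) \sum_(l < N) psi k l.
  have -> : \sum_(i | P i) n i ^+ 2 / w i =
      \sum_(k < N) \sum_(l < N) \sum_(i | P i) (iota k == i)%:R * (iota l == i)%:R / w i.
    under [RHS]eq_bigr do rewrite exchange_big/=.
    rewrite exchange_big/=; apply: eq_bigr => i _.
    rewrite expr2 /n !mulr_suml; apply: eq_bigr => k _.
    by rewrite mulr_sumr mulr_suml.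
  apply: ler_sum => k _; apply: ler_sum => l _.
  rewrite (bigD1 (iota k))//= eqxx big1 ?addr0; last first.
    by move=> i /andP[_]; rewrite eq_sym => /negPf ->; rewrite !mul0r.
  by rewrite mul1r; case: eqP => [kl|_]; rewrite ?mul0r// mul1r psiw.
rewrite ler_pdivlMr// mulrC Nn; set lhs := 2 * _.
apply: (@le_trans _ _ (T * \sum_(i | P i) w i + T^-1 * \sum_(i | P i) n i ^+ 2 / w i)); last first.
  by rewrite lerD2l ler_pM2l// invr_gt0.
rewrite /lhs !mulr_sumr -big_split/=; apply: ler_sum => i Pii.
have wi := w0 _ Pii; have Tw : 0 < T * w i by rewrite mulr_gt0.
have -> : T * w i + T^-1 * (n i ^+ 2 / w i) = (n i - T * w i) ^+ 2 / (T * w i) + 2 * n i.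
  by field; rewrite !gt_eqF.
by rewrite lerDr divr_ge0 ?sqr_ge0// ltW.
Qed.

Lemma grid_count (N : nat) (al h p r : R) : 0 < h -> 0 <= r ->
  \sum_(j < N) (`|(al + h * j%:R)%R - p| < r)%R%:R <= 2 * r / h + 1 :> R.
Proof.
move=> h0 r0; apply: (@sum_narrow_le _ (fun j : nat => `|al + h * j%:R - p| < r)).
  by rewrite divr_ge0 ?mulr_ge0// ltW.
move=> i j ij; rewrite !ltr_norml => /andP[i1 i2] /andP[j1 j2].
rewrite ler_pdivlMr// natrB// mulrC mulrBr; lra.
Qed.

End energy.

(** * Separated families of lines *)

Section core.
Context {R : realType}.
Local Notation mu := (@lebesgue_measure R).

Lemma ltr_pair_norm (x y r : R) (c : R * R) :
  (`|(x, y) - c| < r) = (`|x - c.1| < r) && (`|y - c.2| < r).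
Proof. by rewrite prod_normE/= gt_max. Qed.

(** Compactness of the segment of the line over [al, be]. *)
Lemma segment_finite_subcover (a b al be : R) (c : nat -> R * R) (r : nat -> R) :
  (forall xi, al <= xi <= be -> exists i, `|(xi, a * xi + b) - c i| < r i) ->
  exists m, forall xi, al <= xi <= be ->
    exists2 i, (i < m)%N & `|(xi, a * xi + b) - c i| < r i.
Proof.
move=> cov; have := @segment_compact R al be; rewrite compact_cover.
move=> /(_ nat setT (fun i => [set xi | `|(xi, a * xi + b) - c i| < r i])) [].
- move=> i _; pose f (xi : R) : R := a * xi + b.
  have cf : continuous f.
    move=> xi; apply: cvgD; last exact: cvg_cst.
    by apply: cvgM; [exact: cvg_cst|exact: cvg_id].
  have -> : [set xi | `|(xi, a * xi + b) - c i| < r i] =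
      ball (c i).1 (r i) `&` f @^-1` (ball (c i).2 (r i)).
    apply/seteqP; split=> xi; rewrite /= ltr_pair_norm /ball/= (distrC (c i).1) (distrC (c i).2).
      by move=> /andP[].
    by move=> [-> ->].
  apply: openI; first exact: ball_open.
  by apply: open_comp; [move=> xi _; exact: cf|exact: ball_open].
- by move=> xi; rewrite /= in_itv/= => /cov[i ?]; exists i.
- move=> D _ Dcov; exists (\max_(i <- finmap.enum_fset D) i).+1 => xi xiab.
  have [|i iD ?] := Dcov xi; first by rewrite /= in_itv.
  by exists i => //; rewrite ltnS; apply: leq_bigmax_seq.
Qed.

(** The energy of N lines with separated indices, observed at N abscissae, is
    O(N^3) with a constant that depends neither on N nor on the cover, whereas the
    squares of a cover with small sum of r^s would force it to be larger.  The
    index set Y is arbitrary, so the argument is carried by outer measure. *)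
Lemma line_family_not_null (U : set (R * R)) (s al be kap : R) (Y : set R)
    (a b : R -> R) :
  1 < s < 2 -> al < be -> 0 < kap -> has_lbound Y -> (0 < mu Y)%E ->
  (forall y, Y y -> forall xi, al <= xi <= be -> U (xi, a y * xi + b y)) ->
  (forall y z, Y y -> Y z -> exists2 xi, al <= xi <= be &
      kap * `|y - z| <= `|(a y - a z) * xi + (b y - b z)|) ->
  ~ null s U.
Proof.
move=> /andP[s1 s2] albe kap0 lbY muY YU sep nU.
have [c c0 cY] : exists2 c : R, 0 < c & (c%:E < mu Y)%E.
  case muYE : (mu Y) muY => [x| |]//; last by exists 1; rewrite ?ltry.
  by rewrite lte_fin => x0; exists (x / 2); rewrite ?lte_fin; lra.
pose sg := s - 1; have sg01 : 0 < sg < 1 by rewrite /sg; lra.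
have /andP[sg0 sg1] := sg01.
pose L := be - al; have L0 : 0 < L by rewrite subr_gt0.
pose K := kap * c / 2; have K0 : 0 < K by rewrite divr_gt0// mulr_gt0.
pose C := energy_const sg c K.
have C0 : 0 < C.
  have s10 : 0 < 1 - sg by rewrite subr_gt0.
  apply: addr_gt0; first by rewrite mulr_gt0// powR_gt0// divr_gt0.
  by rewrite divr_gt0 ?exprn_gt0// mulr_gt0// powR_gt0// divr_gt0.
pose K1 := 2 / L + 2 / c; have K10 : 0 < K1 by rewrite addr_gt0 ?divr_gt0.
(* With T = N C in [classes_energy] the two sides of the final inequality are N^2
   and (3 / 4) N^2. *)
pose e := (2 * C * K1)^-1; have e0 : 0 < e by rewrite invr_gt0 !mulr_gt0.
have [cc [r [r0 rs cov]]] := nU _ e0.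
pose Ym m := Y `&` [set y | forall xi, al <= xi <= be ->
    exists2 i, (i < m)%N & `|(xi, a y * xi + b y) - cc i| < r i].
(* The constants C and K1 depend on c, which is why outer measure greater than c
   must survive the passage to finitely many squares. *)
have [m cYm] : exists m, (c%:E < mu (Ym m))%E.
  apply: outer_nondecreasing_bigcup.
    move=> m n mn; apply/subsetPset => y [Yy yc]; split=> // xi /yc[i im ?].
    by exists i => //; exact: leq_trans mn.
  apply: lt_le_trans cY _; apply: outer_le => y Yy.
  have [m mP] := @segment_finite_subcover (a y) (b y) al be cc r
    (fun xi xiab => cov _ (YU y Yy xi xiab)).
  by exists m.
(* N is so large that the truncation c / 2 / N is below all radii that occur. *)
have [N N0 Nr] : exists2 N, (0 < N)%N &
    forall i, (i < m)%N -> 0 < r i -> c / 2 / N%:R <= r i.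
  (* Zero radii contribute nothing to S since / 0 is 0. *)
  pose S := \sum_(i < m) (c / 2 / r i); exists (Num.truncn S).+1 => // i im ri.
  rewrite ler_pdivrMr// [leRHS]mulrC -ler_pdivrMr//.
  apply: (@le_trans _ _ S); last exact/ltW/Num.Theory.truncnS_gt.
  rewrite /S (bigD1 (Ordinal im))//= lerDl sumr_ge0// => j _.
  by rewrite !divr_ge0// ltW.
have NR : 0 < N%:R :> R by rewrite ltr0n.
pose d := c / 2 / N%:R; have d0 : 0 < d by rewrite !divr_gt0.
have [y [Yy ysep]] : exists x : nat -> R, (forall k, (k < N)%N -> Ym m (x k)) /\
    (forall k l, (k <= l < N)%N -> d *+ (l - k) <= x l - x k).
  apply: outer_spread => //; first by case: lbY => z Yz; exists z => x [/Yz].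
  have -> // : (2 * d) *+ N = c.
  by rewrite -mulr_natl /d; field; rewrite gt_eqF.
have ydist k l : (k < N)%N -> (l < N)%N -> d * (dist k l)%:R <= `|y k - y l|.
  move=> kN lN; rewrite mulr_natr /dist; case: (leqP k l) => [kl|/ltnW lk].
    rewrite distrC (eqP kl) add0n; apply: le_trans (ler_norm _).
    by apply: ysep; rewrite kl.
  by rewrite (eqP lk) addn0; apply: le_trans (ler_norm _); apply: ysep; rewrite lk.
pose u k l := (a (y k) - a (y l)) * al + (b (y k) - b (y l)).
pose A k l := (a (y k) - a (y l)) * (L / N%:R).
pose psi k l (j : nat) := Num.max (`|u k l + A k l * j%:R| / 2) d `^ (- sg).
have energy : \sum_(k < N) \sum_(l < N) \sum_(j < N) psi k l j <= C * N%:R ^+ 3.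
  apply: total_energy => // k l kN lN kl.
  have [Yk _] := Yy k kN; have [Yl _] := Yy l lN.
  have [xi /andP[xi1 xi2] h] := sep _ _ Yk Yl.
  exists ((xi - al) * N%:R / L).
    apply/andP; split; first by rewrite divr_ge0 ?mulr_ge0 ?subr_ge0// ltW.
    by rewrite ler_pdivrMr// mulrC ler_pM2l// lerB.
  have -> : u k l + A k l * ((xi - al) * N%:R / L) =
      (a (y k) - a (y l)) * xi + (b (y k) - b (y l)).
    by rewrite /u /A; field; rewrite !gt_eqF.
  apply: le_trans h; apply: (@le_trans _ _ (kap * (d * (dist k l)%:R))).
    by rewrite le_eqVlt; apply/orP; left; apply/eqP; rewrite /K /d; field; rewrite gt_eqF.
  by rewrite ler_pM2l// ydist.
pose x j := al + L / N%:R * j%:R.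
have xab j : (j < N)%N -> al <= x j <= be.
  move=> jN; rewrite /x lerDl mulr_ge0 ?divr_ge0 ?(ltW L0)//= -lerBrDl.
  rewrite mulrAC ler_pdivrMr// ler_pM2l// ler_nat; exact: ltnW.
pose P j : pred 'I_m := fun i => `|x j - (cc i).1| < r i.
have each j : (j < N)%N -> N%:R <= (N%:R * C * \sum_(i | P j i) r i `^ sg +
    (N%:R * C)^-1 * \sum_(k < N) \sum_(l < N) psi k l j) / 2.
  move=> jN.
  have /choice[iota iotaP] : forall k : 'I_N, exists i : 'I_m,
      `|(x j, a (y k) * x j + b (y k)) - cc i| < r i.
    move=> k; have [_ /(_ _ (xab j jN))[i im h]] := Yy k (ltn_ord k).
    by exists (Ordinal im).
  have iota1 k : P j (iota k) by have := iotaP k; rewrite ltr_pair_norm => /andP[].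
  have rpos i : P j i -> 0 < r i by apply: le_lt_trans; exact: normr_ge0.
  apply: (@classes_energy _ N m iota (P j) (fun i => r i `^ sg)
    (fun k l => psi k l j)) => //.
  - by rewrite mulr_gt0.
  - by move=> i /rpos ri; rewrite powR_gt0.
  - by move=> k l; rewrite powR_ge0.
  - move=> k l kl; rewrite -powRN; apply: ler_powRN; first exact: ltW.
      by rewrite lt_max d0 orbT.
    have ri := rpos _ (iota1 k).
    rewrite ge_max Nr// andbT.
    have := iotaP k; have := iotaP l; rewrite -kl !ltr_pair_norm.
    move=> /andP[_]; rewrite ltr_norml => /andP[l1 l2].
    move=> /andP[_]; rewrite ltr_norml => /andP[k1 k2].
    have -> : u k l + A k l * j%:R =
        (a (y k) * x j + b (y k)) - (a (y l) * x j + b (y l)).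
      by rewrite /u /A /x; ring.
    rewrite ler_pdivrMr// ler_norml; apply/andP; split; lra.
(* A square of radius r >= c / 2 / N is met at O(N r) abscissae. *)
have active : \sum_(j < N) \sum_(i | P j i) r i `^ sg <= N%:R * K1 * e.
  have -> : \sum_(j < N) \sum_(i | P j i) r i `^ sg =
      \sum_(i < m) r i `^ sg * \sum_(j < N) (`|(x j)%R - (cc i).1| < r i)%R%:R.
    under eq_bigr do rewrite big_mkcond/=.
    rewrite exchange_big/=; apply: eq_bigr => i _; rewrite mulr_sumr.
    by apply: eq_bigr => j _; rewrite /P; case: ifP; rewrite ?mulr1 ?mulr0.
  apply: (@le_trans _ _ (\sum_(i < m) N%:R * K1 * r i `^ s)); last first.
    by rewrite -mulr_sumr ler_pM2l ?mulr_gt0.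
  apply: ler_sum => i _; have s0 : 0 < s by lra.
  rewrite -(mulr_powRB1 (r0 i) s0) mulrA [leRHS]mulrC.
  have [ri|ri] := eqVneq (r i) 0; first by rewrite ri powR0 ?mul0r// gt_eqF.
  have {}ri : 0 < r i by rewrite lt_neqAle eq_sym ri r0.
  rewrite ler_wpM2l ?powR_ge0//; apply: (le_trans (grid_count _ _ _ _ (ltW ri))).
    by rewrite divr_gt0.
  have := Nr i (ltn_ord i) ri; rewrite ler_pdivrMr// ler_pdivrMr// => cr.
  have -> : 2 * r i / (L / N%:R) = N%:R * (2 / L) * r i.
    by field; rewrite !gt_eqF.
  rewrite /K1 mulrDr mulrDl lerD2l mulrA mulrAC ler_pdivlMr//; lra.
have total : N%:R * N%:R <= (N%:R * C * (N%:R * K1 * e) +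
    (N%:R * C)^-1 * (C * N%:R ^+ 3)) / 2.
  rewrite -[leLHS]sum_ord_const.
  apply: (@le_trans _ _ (\sum_(j < N) ((N%:R * C * \sum_(i | P j i) r i `^ sg +
    (N%:R * C)^-1 * \sum_(k < N) \sum_(l < N) psi k l j) / 2))).
    by apply: ler_sum => j _; exact: each.
  rewrite -mulr_suml ler_pM2r// big_split/= -!mulr_sumr lerD//.
    by rewrite ler_pM2l ?mulr_gt0.
  rewrite ler_pM2l ?invr_gt0 ?mulr_gt0//; apply: le_trans energy.
  rewrite exchange_big/=; apply: ler_sum => k _.
  by rewrite exchange_big.
have : (N%:R * C * (N%:R * K1 * e) + (N%:R * C)^-1 * (C * N%:R ^+ 3)) / 2 =
    N%:R * N%:R * (3 / 4) :> R.
  by rewrite /e; field; rewrite !gt_eqF.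
move=> totE; move: total; rewrite totE; have : 0 < N%:R * N%:R :> R by rewrite mulr_gt0.
lra.
Qed.

End core.

(** * Lines through the points of a plane graph *)

Section plane.
Context {R : realType}.
Local Notation mu := (@lebesgue_measure R).
Variables (al be Lam : R) (phi dphi : R -> R).
Let I : set R := [set x | al < x < be].
Hypothesis albe : al < be.
Hypothesis Lam0 : 0 < Lam.
Hypothesis phiD : forall x, I x -> is_derive x 1 phi (dphi x).
Hypothesis dphiL : forall x y, I x -> I y -> `|dphi x - dphi y| <= Lam * `|x - y|.

(** The mean value theorem, symmetric in the order of the two points. *)
Lemma mean_value x z : I x -> I z ->
  exists y, [/\ I y, `|y - z| <= `|x - z| & phi x - phi z = dphi y * (x - z)].
Proof.
have mvt u v : I u -> I v -> u <= v ->
    exists2 y, u <= y <= v & phi v - phi u = dphi y * (v - u).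
  move=> /andP[u1 u2] /andP[v1 v2] uv.
  have Iuv y : y \in `[u, v]%R -> I y.
    rewrite in_itv/= => /andP[uy yv].
    by rewrite /I/= (lt_le_trans u1)//= (le_lt_trans yv).
  have [] := @MVT_segment R phi dphi u v uv.
  - by move=> y yuv; apply/phiD/Iuv; apply: subset_itv_oo_cc.
  - by apply: derivable_within_continuous => y /Iuv /phiD [].
  - by move=> y; rewrite in_itv/= => ? ?; exists y.
move=> Ix Iz; have [xz|/ltW zx] := leP x z.
  have [y yxz e] := mvt _ _ Ix Iz xz; exists y.
  case/andP: Ix Iz yxz => x1 x2 /andP[z1 z2] /andP[xy yz].
  split; first by rewrite /I/= (lt_le_trans x1 xy) (le_lt_trans yz z2).
    by rewrite !ler0_norm ?subr_le0//; lra.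
  by rewrite -[LHS]opprB e; ring.
have [y yxz e] := mvt _ _ Iz Ix zx; exists y.
case/andP: Ix Iz yxz => x1 x2 /andP[z1 z2] /andP[xy yz].
split=> //; first by rewrite /I/= (lt_le_trans z1 xy) (le_lt_trans yz x2).
by rewrite !ger0_norm ?subr_ge0//; lra.
Qed.

Lemma image_dphi x1 x2 v : I x1 -> I x2 -> dphi x1 <= v <= dphi x2 ->
  exists2 x, I x & dphi x = v.
Proof.
move=> I1 I2 v12.
have cd x : I x -> {for x, continuous dphi}.
  move=> Ix; have /andP[ax xb] := Ix; apply/cvgrPdist_lt => e e0.
  have nI : \forall y \near x, I y.
    have /near_in_itvoo : x \in `]al, be[ by rewrite in_itv.
    by apply: filterS => y; rewrite in_itv.
  near=> y; have Iy : I y by near: y.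
  apply: (le_lt_trans (dphiL Ix Iy)); rewrite mulrC -ltr_pdivlMr//.
  by near: y; apply: cvgr_dist_lt => //; rewrite divr_gt0.
have wc u w : I u -> I w -> {within `[u, w], continuous dphi}.
  move=> /andP[u1 u2] /andP[w1 w2].
  apply: continuous_in_subspaceT => x; rewrite inE/= in_itv/= => /andP[ux xw].
  by apply: cd; rewrite /I/= (lt_le_trans u1 ux) (le_lt_trans xw w2).
have [x12|/ltW x21] := leP x1 x2.
  have [|x] := @IVT R dphi x1 x2 v x12 (wc _ _ I1 I2).
    by case/andP: v12 => v1 v2; rewrite ge_min v1 le_max v2 orbT.
  rewrite in_itv/= => /andP[h1 h2] xv; exists x => //.
  by case/andP: I1 I2 => a1 _ /andP[_ b2]; rewrite /I/= (lt_le_trans a1 h1) (le_lt_trans h2).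
have [|x] := @IVT R dphi x2 x1 v x21 (wc _ _ I2 I1).
  by case/andP: v12 => v1 v2; rewrite ge_min v1 le_max v2 !orbT.
rewrite in_itv/= => /andP[h1 h2] xv; exists x => //.
by case/andP: I1 I2 => _ b2 /andP[a1 _]; rewrite /I/= (lt_le_trans a1 h1) (le_lt_trans h2).
Unshelve. all: by end_near. Qed.

Variables (U : set (R * R)) (s : R).
Hypothesis s12 : 1 < s < 2.
Hypothesis Unull : null s U.

(** Some horizontal slice is null in dimension s - 1 < 1, and it contains a point
    of each vertical line. *)
Lemma vertical_outer0 (V : set R) : (forall x t, V x -> U (x, t)) -> mu V = 0%E.
Proof.
move=> VU; have /andP[s1 s2] := s12.
have sndL (x y : R * R) : `|x.2 - y.2| <= 1 * `|x - y|.
  by rewrite mul1r prod_normE/= le_max lexx orbT.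
have fstL (x y : R * R) : `|x.1 - y.1| <= 1 * `|x - y|.
  by rewrite mul1r prod_normE/= le_max lexx.
have [t _ nt] := null_slice ltr01 sndL ltr01 s1 Unull.
apply: (@null_outer0 _ (s - 1)); first lra.
apply: nullS (null_lipschitz_image (f := fst) ltr01 (fun x y _ _ => fstL x y) nt).
by move=> x Vx; exists (x, t) => //; split=> //=; exact: VU.
Qed.

(** Cut the interval into pieces on which the derivative varies by at most eta / 2.
    On one piece, the line at z crosses the graph at an angle that is bounded below
    near z, so above x it is at distance at least (eta / 2) |x - z| from the graph,
    hence from the line at x. *)
Lemma transverse_outer0 (a : R -> R) (eta : R) (X : set R) : 0 < eta ->
  X `<=` I -> (forall x, X x -> forall xi, U (xi, a x * (xi - x) + phi x)) ->
  (forall x, X x -> eta <= `|a x - dphi x|) -> mu X = 0%E.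
Proof.
move=> eta0 XI XU tr.
pose h := eta / (2 * Lam); have h0 : 0 < h by rewrite divr_gt0// mulr_gt0.
pose piece k := X `&` `[al + h * k%:R, al + h * k.+1%:R]%classic.
have cov : X `<=` \bigcup_k piece k.
  move=> x Xx; have /andP[ax _] := XI _ Xx.
  have q0 : 0 <= (x - al) / h by rewrite divr_ge0 ?subr_ge0// ltW.
  have /Num.Theory.truncn_itv/andP[k1 k2] := q0.
  exists (Num.truncn ((x - al) / h)) => //; split=> //; rewrite /= in_itv/=.
  rewrite -lerBrDl mulrC -ler_pdivlMr// k1/=.
  by rewrite -lerBlDl mulrC -ler_pdivrMr// ltW.
apply/eqP; rewrite eq_le outer_ge0 andbT -(outer_bigcup0 (F := piece)) ?outer_le//.
move=> k; apply/eqP; rewrite eq_le outer_ge0 andbT leNgt; apply/negP => pos.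
apply: (@line_family_not_null _ U s al be (eta / 2) (piece k) a (fun x => phi x - a x * x)) => //.
- by rewrite divr_gt0.
- by exists al => x [/XI/andP[/ltW]].
- by move=> x [Xx _] xi _; have := XU _ Xx xi; rewrite mulrBr -addrA addrC [- _ + _]addrC addrC.
- move=> x z [Xx xk] [Xz zk]; have Ix := XI _ Xx; have Iz := XI _ Xz.
  exists x; first by have /andP[/ltW -> /ltW ->] := Ix.
  have [y [Iy yz e]] := mean_value Ix Iz.
  have -> : (a x - a z) * x + (phi x - a x * x - (phi z - a z * z)) =
      (phi x - phi z) - a z * (x - z) by ring.
  rewrite e -mulrBl normrM ler_wpM2r//.
  have xz : `|x - z| <= h.
    move: xk zk; rewrite /= !in_itv/= -natr1 mulrDr mulr1 => /andP[? ?] /andP[? ?].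
    by rewrite ler_norml; apply/andP; split; lra.
  have := tr _ Xz; have := dphiL Iy Iz.
  have : Lam * `|y - z| <= eta / 2.
    apply: (@le_trans _ _ (Lam * h)); first by rewrite ler_pM2l// (le_trans yz).
    by rewrite le_eqVlt; apply/orP; left; apply/eqP; rewrite /h; field; rewrite gt_eqF.
  have : `|a z - dphi z| <= `|dphi y - a z| + `|dphi y - dphi z|.
    have -> : a z - dphi z = (dphi y - dphi z) - (dphi y - a z) by ring.
    by rewrite [leRHS]addrC; exact: ler_normB.
  lra.
Qed.

(** Two lines whose slopes differ by y - z are (be - al) |y - z| / 2 apart at one
    of the end points. *)
Lemma tangent_image_outer0 (X : set R) : X `<=` I ->
  (forall x, X x -> forall xi, U (xi, dphi x * (xi - x) + phi x)) ->
  mu (dphi @` X) = 0%E.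
Proof.
move=> XI XU; apply/eqP; rewrite eq_le outer_ge0 andbT leNgt; apply/negP => pos.
have /choice[p pP] : forall y, exists x, (dphi @` X) y -> X x /\ dphi x = y.
  move=> y; have [[x Xx xy]|nX] := pselect ((dphi @` X) y); first by exists x.
  by exists 0.
apply: (@line_family_not_null _ U s al be ((be - al) / 2) (dphi @` X) id
  (fun y => phi (p y) - y * p y)) => //.
- by rewrite divr_gt0// subr_gt0.
- pose m := (al + be) / 2; exists (dphi m - Lam * (be - al)) => _ [x /XI Ix <-].
  have Im : I m.
    by rewrite /I/= /m !(midf_lt albe).
  have : `|m - x| <= be - al.
    by case/andP: Im Ix => ? ? /andP[? ?]; rewrite ler_norml; apply/andP; split; lra.
  rewrite -(ler_pM2l Lam0); have := dphiL Im Ix.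
  move: (Lam * (be - al)) (Lam * `|m - x|) => p1 p2.
  by rewrite ler_norml => /andP[? ?] ?; lra.
- move=> y Yy xi _; have [Xp py] := pP _ Yy.
  have -> : y * xi + (phi (p y) - y * p y) = dphi (p y) * (xi - p y) + phi (p y).
    by rewrite py; ring.
  exact: XU.
- move=> y z _ _; pose b w := phi (p w) - w * p w.
  pose g xi : R := (y - z) * xi + (b y - b z).
  have tri : (be - al) * `|y - z| <= `|g be| + `|g al|.
    have -> : (be - al) * `|y - z| = `|g be - g al|.
      rewrite (_ : g be - g al = (be - al) * (y - z)); last by rewrite /g; ring.
      by rewrite normrM [X in _ = X * _]gtr0_norm// subr_gt0.
    exact: ler_normB.
  have [h|h] := leP ((be - al) / 2 * `|y - z|) `|g be|.
    by exists be; rewrite ?lexx ?(ltW albe).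
  by exists al; rewrite ?lexx ?(ltW albe)//; rewrite -/(g al); lra.
Qed.

(** Up to a set of outer measure zero, the line at each point is tangent; so the
    image of the Lipschitz derivative is null, and it is an interval. *)
Lemma lines_derivative_constant :
  (forall x, I x -> exists u v, (u != 0) || (v != 0) /\
     forall t, U (x + t * u, phi x + t * v)) ->
  forall x1 x2, I x1 -> I x2 -> dphi x1 = dphi x2.
Proof.
move=> lines; suff no x1 x2 : I x1 -> I x2 -> ~ dphi x1 < dphi x2.
  move=> x1 x2 I1 I2; apply/eqP; rewrite eq_le !leNgt.
  by apply/andP; split; apply/negP; apply: no.
move=> I1 I2 lt12.
pose V : set R := [set x | forall t, U (x, t)].
have /choice[a aP] : forall x, exists a, I x -> ~ V x ->
    forall xi, U (xi, a * (xi - x) + phi x).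
  move=> x; have [Ix|nI] := pselect (I x); last by exists 0.
  have [u [v [uv Uuv]]] := lines x Ix; have [u0|u0] := eqVneq u 0.
    exists 0 => _ nV; exfalso; apply: nV => t.
    move: uv; rewrite u0 eqxx/= => v0; have := Uuv ((t - phi x) / v).
    by rewrite u0 mulr0 addr0 divfK// subrKC.
  exists (v / u) => _ _ xi; have := Uuv ((xi - x) / u).
  by rewrite divfK// subrKC addrC mulrAC [v / u * _]mulrAC [v * _]mulrC.
pose G := I `&` ~` V.
(* Transversality is made quantitative; countably many levels suffice. *)
pose Tr (j : nat) := G `&` [set x | j.+1%:R^-1 <= `|a x - dphi x|].
pose T := G `&` [set x | a x = dphi x].
have IE : I `<=` (I `&` V) `|` \bigcup_j Tr j `|` T.
  move=> x Ix; have [Vx|nV] := pselect (V x); first by left; left.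
  have [e|ne] := eqVneq (a x) (dphi x); first by right.
  left; right; have : 0 < `|a x - dphi x| by rewrite normr_gt0 subr_eq0.
  move=> pos; exists (Num.truncn `|a x - dphi x|^-1) => //; split=> //=.
  rewrite -[leRHS]invrK lef_pV2 ?posrE ?invr_gt0//.
  exact/ltW/Num.Theory.truncnS_gt.
have bad0 : mu (dphi @` ((I `&` V) `|` \bigcup_j Tr j)) = 0%E.
  apply: (outer0_lipschitz_image Lam0).
    move=> x y Bx By; apply: dphiL; [case: Bx|case: By];
      by [case|case=> ? _ [[]]].
  apply: outerU0; first by apply: vertical_outer0 => x t [_]; exact.
  apply: outer_bigcup0 => j; apply: (@transverse_outer0 a j.+1%:R^-1) => //.
  - by move=> x [[]].
  - by move=> x [[Ix nV] _]; exact: aP.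
  - by move=> x [].
have T0 : mu (dphi @` T) = 0%E.
  apply: tangent_image_outer0; first by move=> x [[]].
  by move=> x [[Ix nV] /= <-]; exact: aP.
have : mu `[dphi x1, dphi x2]%classic = 0%E.
  apply/eqP; rewrite eq_le outer_ge0 andbT -(outerU0 bad0 T0) outer_le//.
  move=> v; rewrite /= in_itv/= => /(image_dphi I1 I2)[x /IE Ix <-].
  by case: Ix => Bx; [left|right]; exists x.
rewrite lebesgue_measure_itv/= lte_fin lt12 -EFinB => /eqP.
by rewrite eqe subr_eq0 => /eqP e; rewrite e ltxx in lt12.
Qed.

End plane.

(** * Norms, countable unions and cubes *)

Section norms.
Context {R : realType}.

Lemma rV_norm_lt N (x : 'rV[R]_N) (e : R) :
  0 < e -> (forall j, `|x 0 j| < e) -> `|x| < e.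
Proof.
move=> e0 xe; have [x0|/mx_norm_neq0[[i j] xij]] := eqVneq (mx_norm x) 0.
  by rewrite [`|x|]x0.
by rewrite [`|x|]xij/= (ord1 i) xe.
Qed.

Lemma rV_norm_le N (x : 'rV[R]_N) (e : R) :
  0 <= e -> (forall j, `|x 0 j| <= e) -> `|x| <= e.
Proof.
move=> e0 xe; have [x0|/mx_norm_neq0[[i j] xij]] := eqVneq (mx_norm x) 0.
  by rewrite [`|x|]x0.
by rewrite [`|x|]xij/= (ord1 i) xe.
Qed.

Lemma le_rV_norm N (x : 'rV[R]_N) j : `|x 0 j| <= `|x|.
Proof.
rewrite [leRHS]mx_normrE.
by apply: (le_bigmax_cond _ (fun ij => `|x ij.1 ij.2|) (j := (0, j))).
Qed.

Lemma rV_norm_le_euclidean N (x : 'rV[R]_N) : `|x| <= euclidean_norm x.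
Proof.
apply: rV_norm_le; first exact: sqrtr_ge0.
move=> j; rewrite -sqrtr_sqr /euclidean_norm ler_sqrt; last first.
  by apply: sumr_ge0 => i _; exact: sqr_ge0.
rewrite (bigD1 j)//= lerDl; apply: sumr_ge0 => i _; exact: sqr_ge0.
Qed.

Lemma euclidean_le_rV_norm N (x : 'rV[R]_N) :
  euclidean_norm x <= (N%:R + 1) * `|x|.
Proof.
rewrite -[leRHS]ger0_norm ?mulr_ge0 ?addr_ge0//.
rewrite -sqrtr_sqr; apply: ler_wsqrtr.
apply: (@le_trans _ _ (\sum_(i < N) `|x| ^+ 2)).
  apply: ler_sum => i _; rewrite -[leLHS]real_normK ?num_real//.
  by rewrite lerXn2r ?nnegrE// le_rV_norm.
rewrite sumr_const card_ord exprMn -[leLHS]mulr_natl ler_wpM2r ?sqr_ge0//.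
have -> : (N%:R + 1) ^+ 2 = N%:R + (N%:R ^+ 2 + N%:R + 1) :> R by ring.
by rewrite lerDl !addr_ge0// exprn_ge0.
Qed.

End norms.

Section unions.
Context {R : realType}.
Variable V : normedModType R.

(** Finite covers by balls of equal radius suffice; the sequence is completed by
    balls of radius 0. *)
Lemma null_finite_cover (s : R) (X : set V) : s != 0 ->
  (forall e, 0 < e -> exists (T : finType) (c : T -> V) (r : R),
    [/\ 0 <= r, #|T|%:R * r `^ s <= e & forall x, X x -> exists t, `|x - c t| < r]) ->
  null s X.
Proof.
move=> s0 fin e e0; have [T [c [r [r0 rs cov]]]] := fin e e0.
pose c' i := nth 0 [seq c t | t <- enum T] i.
exists c', (fun i => if (i < #|T|)%N then r else 0); split.
- by move=> i; case: ifP.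
- move=> m; apply: le_trans rs.
  apply: (@le_trans _ _ (\sum_(i < m) (i < #|T|)%N%:R * r `^ s)).
    by apply: ler_sum => i _; case: ifP => _; rewrite ?mul1r// powR0// mul0r.
  rewrite -mulr_suml ler_wpM2r ?powR_ge0//.
  rewrite -natr_sum ler_nat; elim: m => [|m IH]; first by rewrite big_ord0.
  rewrite big_ord_recr/=; case: (ltnP m #|T|) => mT; last by rewrite addn0.
  apply: (@leq_trans m.+1) => //; rewrite addn1 ltnS.
  apply: (@leq_trans (\sum_(i < m) 1)%N); last by rewrite sum1_card card_ord.
  by apply: leq_sum => i _; case: (_ < _)%N.
- move=> x /cov[t xt]; exists (enum_rank t).
  by rewrite ltn_ord /c' (nth_map t) -?cardE ?ltn_ord// nth_enum_rank.
Qed.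

(** The usual division of e into e / 2^(k + 1), with the double sequence of balls
    enumerated by a bijection between nat and nat * nat. *)
Lemma null_bigcup (s : R) (X : nat -> set V) :
  (forall k, null s (X k)) -> null s (\bigcup_k X k).
Proof.
move=> nX e e0; pose ek k : R := e / (2 ^ k.+1)%:R.
have ek0 k : 0 < ek k by rewrite divr_gt0// ltr0n expn_gt0.
have /choice[c cP] := fun k => nX k _ (ek0 k).
have /choice[r rP] := cP.
have [f bf] : exists f : nat -> nat * nat, set_bij setT setT f.
  have /pcard_eqP/bijPex[f bf] : ([set: nat] #= [set: nat * nat])%card.
    by rewrite card_eq_sym; exact: card_nat2.
  by exists f.
pose a (k : nat * nat) : \bar R := (r k.1 k.2 `^ s)%:E.
have a0 k : (0 <= a k)%E by rewrite lee_fin powR_ge0.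
exists (fun n => c (f n).1 (f n).2), (fun n => r (f n).1 (f n).2); split.
- by move=> n; have [] := rP (f n).1.
- move=> m; rewrite -lee_fin -sumEFin.
  apply: (@le_trans _ _ (\sum_(n <oo) a (f n))%E).
    by rewrite -(big_mkord xpredT (fun n => a (f n))); apply: nneseries_lim_ge.
  rewrite nneseries_esumT// -(reindex_esum _ _ _ a bf).
  have -> : [set: nat * nat] = [set: nat] `*`` (fun=> [set: nat]) by rewrite eqEsubset.
  rewrite -(esum_esum (a := fun k i => a (k, i)))//.
  rewrite -nneseries_esumT; last by move=> k; exact: esum_ge0.
  apply: (le_trans _ (epsilon_trick0 xpredT (ltW e0))).
  apply: lee_nneseries => [k _ _|k _]; first exact: esum_ge0.
  rewrite -nneseries_esumT//; apply: lime_le; first exact: is_cvg_nneseries.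
  apply: nearW => j; rewrite big_mkord sumEFin lee_fin; have [_ rs _] := rP k.
  exact: rs.
- move=> x [k _ Xkx]; have [_ _ /(_ _ Xkx)[i xi]] := rP k.
  have [_ _ /(_ (k, i) I)[n _ fn]] := bf.
  by exists n; rewrite fn.
Qed.

End unions.

Section cubes.
Context {R : realType}.

(** A cube of side 2 L is covered by (K + 1)^N balls of radius 2 L / K, and
    (K + 1)^N K^(- s) tends to 0 as s > N. *)
Lemma null_setT N (s : R) : N%:R < s -> null s [set: 'rV[R]_N].
Proof.
move=> Ns; have s0 : 0 < s by apply: le_lt_trans Ns.
have -> : [set: 'rV[R]_N] = \bigcup_k [set x | `|x| <= k.+1%:R].
  apply/seteqP; split=> // x _; exists (Num.truncn `|x|) => //=.
  exact/ltW/Num.Theory.truncnS_gt.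
apply: null_bigcup => k; apply: null_finite_cover => [|e e0]; first by rewrite gt_eqF.
set L : R := k.+1%:R; have L0 : 0 < L by [].
pose A := 2 `^ N%:R * (2 * L) `^ s.
have A0 : 0 < A by rewrite mulr_gt0 ?powR_gt0// mulr_gt0.
have sN : 0 < s - N%:R by rewrite subr_gt0.
pose K := (Num.truncn ((A / e) `^ (s - N%:R)^-1)).+1.
have K0 : 0 < K%:R :> R by [].
have AK : A / e <= K%:R `^ (s - N%:R).
  have Ae : 0 <= A / e by rewrite divr_ge0 ?ltW.
  have -> : A / e = ((A / e) `^ (s - N%:R)^-1) `^ (s - N%:R).
    by rewrite -powRrM mulVf ?gt_eqF// powRr1.
  apply: ge0_ler_powR; rewrite ?nnegrE ?powR_ge0//; first exact: ltW.
  exact/ltW/Num.Theory.truncnS_gt.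
pose h := 2 * L / K%:R; have h0 : 0 < h by rewrite divr_gt0// mulr_gt0.
exists {ffun 'I_N -> 'I_K.+1}, (fun g : {ffun 'I_N -> 'I_K.+1} => \row_j (- L + h * (g j)%:R)), h.
split; first exact: ltW.
- rewrite card_ffun !card_ord natrX.
  apply: (@le_trans _ _ ((2 * K%:R) ^+ N * h `^ s)).
    rewrite ler_wpM2r ?powR_ge0// lerXn2r ?nnegrE ?mulr_ge0//.
    by rewrite -natr1 mulr_natl mulr2n lerD2l ler1n.
  have -> : (2 * K%:R) ^+ N * h `^ s = A * K%:R `^ (- (s - N%:R)).
    rewrite /h /A powRM ?mulr_ge0//.
    rewrite exprMn -!powR_mulrn// -(powR_inv1 (ltW K0)) -powRrM mulN1r opprB.
    rewrite powRD; last by rewrite (gt_eqF K0) implybT.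
    by ring.
  rewrite powRN ler_pdivrMr ?powR_gt0//.
  by rewrite mulrC -ler_pdivrMr.
- move=> x /= xL.
  have xj j : - L <= x 0 j <= L by rewrite -ler_norml (le_trans (le_rV_norm x j)).
  have tr j : (Num.truncn ((x 0 j + L) / h)%R < K.+1)%N.
    have /andP[x1 x2] := xj j.
    have q0 : 0 <= (x 0 j + L) / h by rewrite divr_ge0// ?(ltW h0)//; lra.
    rewrite ltnS -(ler_nat R); have /andP[tq _] := Num.Theory.truncn_itv q0.
    apply: (le_trans tq); rewrite ler_pdivrMr// /h mulrC divfK ?gt_eqF//; lra.
  exists [ffun j => Ordinal (tr j)]; apply: rV_norm_lt => // j.
  rewrite !mxE ffunE/=.
  have /andP[x1 x2] := xj j.
  have q0 : 0 <= (x 0 j + L) / h by rewrite divr_ge0// ?(ltW h0)//; lra.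
  have /andP[t1 t2] := Num.Theory.truncn_itv q0.
  move: t1 t2; set t := Num.truncn _.
  rewrite ler_pdivlMr// ltr_pdivrMr// -natr1 mulrDl mul1r (mulrC t%:R) => t1 t2.
  by rewrite ltr_norml; apply/andP; split; lra.
Qed.

End cubes.

(** * Comparison with Hausdorff measure *)

Section hausdorff.
Context {R : realType}.
Variable N : nat.
Implicit Types (s : R) (X : set 'rV[R]_N).

Lemma diam_pow_ge0 s X : (0 <= diam_pow s X)%E.
Proof. by rewrite /diam_pow; case: ifP => // _; exact: poweR_ge0. Qed.

Lemma hausdorff_premeasure_ge0 s (d : R) X : (0 <= hausdorff_premeasure s d X)%E.
Proof.
apply: le_ereal_inf_tmp => _ [U _ <-]; apply: nneseries_ge0 => i _ _.
exact: diam_pow_ge0.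
Qed.

Lemma null_hausdorff s X : 0 < s -> null s X -> hausdorff_measure s X = 0%E.
Proof.
move=> s0 nX; apply/eqP; rewrite eq_le; apply/andP; split; last first.
  apply: (le_trans (hausdorff_premeasure_ge0 s 1 X)).
  by apply: ereal_sup_ubound; exists 1 => //=.
apply: ge_ereal_sup => _ [d /= d0 <-]; apply/lee_addgt0Pr => e e0; rewrite add0e.
(* Factor between the radius in the max norm and the Euclidean diameter. *)
pose B : R := (N%:R + 1) * 2; have B0 : 0 < B by rewrite mulr_gt0// ltr_wpDl.
pose e' := Num.min (e / B `^ s) ((d / B) `^ s).
have e'0 : 0 < e' by rewrite lt_min divr_gt0 ?powR_gt0// divr_gt0.
have [c [r [r0 rs cov]]] := nX _ e'0.
pose U i := [set x : 'rV[R]_N | `|x - c i| < r i].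
have diamU i : (diam (U i) <= (B * r i)%:E)%E.
  apply: ge_ereal_sup => _ [x Ux] [y Uy] <-; rewrite lee_fin.
  apply: (le_trans (euclidean_le_rV_norm _)); rewrite /B -mulrA.
  rewrite ler_wpM2l ?addr_ge0//.
  have -> : x - y = (x - c i) - (y - c i) by rewrite opprB addrA subrK.
  apply: (le_trans (ler_normB _ _)).
  by rewrite mulr_natl mulr2n lerD// ltW.
have rd i : B * r i <= d.
  rewrite mulrC -ler_pdivlMr// leNgt; apply/negP => dr.
  have : r i `^ s <= (d / B) `^ s.
    apply: (@le_trans _ _ e'); last by rewrite ge_min lexx orbT.
    apply: le_trans (rs i.+1); rewrite big_ord_recr/= lerDr.
    by apply: sumr_ge0 => j _; rewrite powR_ge0.
  rewrite leNgt => /negP; apply.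
  by apply: gt0_ltr_powR; rewrite ?nnegrE ?r0// divr_ge0// ltW.
have dpow j : (diam_pow s (U j) <= (B `^ s * r j `^ s)%:E)%E.
  rewrite /diam_pow; case: eqP => [_|/eqP/set0P[x Ux]].
    by rewrite lee_fin mulr_ge0 ?powR_ge0.
  have rj0 := r0 j.
  rewrite -powRM ?(ltW B0)// -poweR_EFin; apply: gt0_ler_poweR; first exact: ltW.
  - rewrite in_itv/= leey andbT; apply: (@le_trans _ _ (euclidean_norm (x - x))%:E).
      by rewrite lee_fin sqrtr_ge0.
    by apply: ereal_sup_ubound; exists x => //; exists x.
  - by rewrite in_itv/= leey andbT lee_fin mulr_ge0// ltW.
  - exact: diamU.
apply: (@le_trans _ _ (\sum_(0 <= i <oo) diam_pow s (U i))%E).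
  apply: ereal_inf_lbound; exists U => //; split.
    by move=> x /cov[i xi]; exists i.
  by move=> i; apply: (le_trans (diamU i)); rewrite lee_fin.
apply: lime_le.
  by apply: is_cvg_nneseries => i _ _; exact: diam_pow_ge0.
apply: nearW => m; rewrite big_mkord.
apply: (@le_trans _ _ (\sum_(i < m) (B `^ s * r i `^ s)%:E)%E).
  by apply: lee_sum => i _; exact: dpow.
rewrite sumEFin lee_fin -mulr_sumr mulrC -ler_pdivlMr ?powR_gt0//.
by apply: (le_trans (rs m)); rewrite ge_min lexx.
Qed.

(** A set of diameter D > 0 lies in the open ball of radius 2 D around any of its
    points; for the sets of diameter 0 the radius is a positive number taken from a
    sequence with small sum.  The exponent may grow because diameters are at
    most 1. *)
Lemma hausdorff_null s s' X : 0 <= s <= s' -> 0 < s' ->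
  hausdorff_measure s X = 0%E -> null s' X.
Proof.
move=> /andP[s0 ss'] s'0 HX e e0.
pose e1 : R := e / 2 / 2 `^ s'; have e10 : 0 < e1 by rewrite !divr_gt0// powR_gt0.
have : (hausdorff_premeasure s 1 X < e1%:E)%E.
  apply: (@le_lt_trans _ _ 0%E); last by rewrite lte_fin.
  by rewrite -HX; apply: ereal_sup_ubound; exists 1 => //=.
move=> /ereal_inf_lt[_ [U [XU U1] <-]] Ue.
have partial m : (\sum_(i < m) diam_pow s (U i) <= e1%:E)%E.
  apply: le_trans (ltW Ue); rewrite -(big_mkord xpredT (fun i => diam_pow s (U i))).
  by apply: nneseries_lim_ge => i _ _; exact: diam_pow_ge0.
(* The s'-th powers of these radii sum to at most e / 2. *)
pose sm (i : nat) : R := (e / 2 / (2 ^ i.+1)%:R) `^ s'^-1.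
have pow0 (i : nat) : 0 < (2 ^ i.+1)%:R :> R by rewrite ltr0n expn_gt0.
have sm0 i : 0 < sm i by rewrite powR_gt0// !divr_gt0.
have smE i : sm i `^ s' = e / 2 / (2 ^ i.+1)%:R.
  rewrite /sm -powRrM mulVf ?gt_eqF// powRr1// ltW// !divr_gt0//.
have /choice[c cP] : forall i, exists x, U i !=set0 -> U i x.
  by move=> i; have [[x Ux]|nU] := pselect (U i !=set0); [exists x|exists 0].
pose D i := fine (diam (U i)).
have DP i : U i !=set0 -> [/\ 0 <= D i, D i <= 1 & diam (U i) = (D i)%:E].
  move=> [x Ux]; have d0 : (0 <= diam (U i))%E.
    apply: (@le_trans _ _ (euclidean_norm (x - x))%:E).
      by rewrite lee_fin sqrtr_ge0.
    by apply: ereal_sup_ubound; exists x => //; exists x.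
  have dE : diam (U i) = (D i)%:E.
    by rewrite fineK// ge0_fin_numE// (le_lt_trans (U1 i)) ?ltry.
  by split=> //; rewrite -lee_fin -dE.
pose r i := if U i == set0 then 0 else Num.max (2 * D i) (sm i).
have DU i x y : U i x -> U i y -> `|x - y| <= D i.
  move=> Ux Uy; have [_ _ dE] : [/\ 0 <= D i, D i <= 1 & diam (U i) = (D i)%:E].
    by apply: DP; exists x.
  apply: (le_trans (rV_norm_le_euclidean _)); rewrite -lee_fin -dE.
  by apply: ereal_sup_ubound; exists x => //; exists y.
exists c, r; split.
- by move=> i; rewrite /r; case: ifP => // _; rewrite le_max (ltW (sm0 i)) orbT.
- move=> m; apply: (@le_trans _ _ (\sum_(i < m) (2 `^ s' * fine (diam_pow s (U i)) +
      e / 2 / (2 ^ i.+1)%:R))).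
    apply: ler_sum => i _; rewrite /r /diam_pow; case: eqP => [_|/eqP/set0P Ui].
      rewrite powR0 ?gt_eqF//= mulr0 add0r ltW// !divr_gt0//.
    have [D0 D1 ->] := DP i Ui; rewrite poweR_EFin/= -smE.
    have DD : (2 * D i) `^ s' <= 2 `^ s' * D i `^ s.
      rewrite powRM// ler_wpM2l ?powR_ge0//.
      have [->|Dn0] := eqVneq (D i) 0; first by rewrite powR0 ?gt_eqF// powR_ge0.
      by apply: ger_powR => //; rewrite lt_neqAle eq_sym Dn0 D0.
    have [h|h] := leP (2 * D i) (sm i); last first.
      by apply: (le_trans DD); rewrite lerDl powR_ge0.
    by rewrite lerDr mulr_ge0 ?powR_ge0.
  rewrite big_split/= -mulr_sumr [leRHS]splitr lerD//.
    rewrite mulrC -ler_pdivlMr ?powR_gt0// -lee_fin -sumEFin.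
    apply: le_trans (partial m); rewrite le_eqVlt; apply/orP; left; apply/eqP.
    apply: eq_bigr => i _; rewrite fineK//.
    rewrite /diam_pow; case: eqP => [//|/eqP/set0P Ui].
    by have [_ _ ->] := DP i Ui; rewrite poweR_EFin.
  rewrite -lee_fin -sumEFin.
  have e20 : 0 <= e / 2 by rewrite divr_ge0// ltW.
  apply: (le_trans _ (epsilon_trick0 xpredT e20)).
  rewrite -(big_mkord xpredT (fun i => (e / 2 / (2 ^ i.+1)%:R)%:E)).
  by apply: nneseries_lim_ge => i _ _; rewrite lee_fin ltW// divr_gt0// divr_gt0.
- move=> x /XU[i _ Uix]; exists i.
  have Ui : U i !=set0 by exists x.
  have -> : r i = Num.max (2 * D i) (sm i).
    by rewrite /r; case: eqP => // U0; move: Uix; rewrite U0.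
  apply: (le_lt_trans (DU i _ _ Uix (cP i Ui))).
  have [D0 _ _] := DP i Ui; rewrite lt_max.
  have [->|Dn0] := eqVneq (D i) 0; first by rewrite sm0 orbT.
  have Dp : 0 < D i by rewrite lt_neqAle eq_sym Dn0.
  by apply/orP; left; lra.
Qed.

End hausdorff.

(** * Derivatives along lines and iterated slices *)

Section geometry.
Context {R : realType}.

Lemma line_is_derive n (f : 'rV[R]_n -> 'rV[R]_1) (y e : 'rV[R]_n) (t : R) :
  differentiable f (y + t *: e) ->
  is_derive t 1 (fun t : R => f (y + t *: e) 0 0) ((e *m 'J f (y + t *: e)) 0 0).
Proof.
set z := y + t *: e => df; set phi := fun t : R => _.
have dfe : derivable f z e by exact: diff_derivable.
pose F z := f z 0 0.
have dF : derivable F z e by move/derivable_mxP : dfe; apply.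
have qE : (fun h : R => h^-1 *: ((phi \o shift t) (h *: (1 : R)) - phi t)) =
    (fun h : R => h^-1 *: ((F \o shift z) (h *: e) - F z)).
  apply/funext => h; congr (_ *: (_ - _)).
  rewrite /phi /F /shift/=; congr (f _ 0 0).
  by rewrite /z [h *: 1]mulr1 scalerDl addrCA.
apply: DeriveDef; first by rewrite /derivable qE; exact: dF.
rewrite /derive qE -[lim _]/('D_e F z) -deriveEjacobian// derive_mx// mxE.
by [].
Qed.

Lemma mulmx_lipschitz m p (A : 'M[R]_(m, p)) :
  exists2 K, 0 < K & forall z : 'rV[R]_m, `|z *m A| <= K * `|z|.
Proof.
exists (\sum_i \sum_j `|A i j| + 1) => [|z].
  by rewrite ltr_wpDl// sumr_ge0// => i _; rewrite sumr_ge0.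
apply: rV_norm_le => [|j]; first by rewrite mulr_ge0// addr_ge0// sumr_ge0// => i _; rewrite sumr_ge0.
rewrite mxE; apply: (le_trans (ler_norm_sum _ _ _)).
rewrite mulrDl mul1r -[leLHS]addr0 lerD// mulr_suml; apply: ler_sum => i _.
rewrite normrM mulrC; apply: ler_pM => //; last exact: le_rV_norm.
by rewrite (bigD1 j)//= lerDl sumr_ge0.
Qed.

Lemma lipschitz_jacobian_bound n m (f : 'rV[R]_n -> 'rV[R]_m) (V : set 'rV[R]_n) :
  [lipschitz 'J f y | y in V] ->
  exists2 K, 0 < K & forall y z, V y -> V z -> `|'J f y - 'J f z| <= K * `|y - z|.
Proof.
move=> [M [_ ML]]; exists (`|M| + 1); first by rewrite ltr_wpDl.
move=> y z Vy Vz; apply: (ML (`|M| + 1) _ (y, z)) => //.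
by rewrite (le_lt_trans (ler_norm _))// ltrDl.
Qed.

(** The hypothesis on s keeps the dimension above 1 before each slice is taken.
    Distinct indices are needed because slicing twice along the same functional
    would lower the dimension only once. *)
Lemma null_slices (V : normedModType R) (I : eqType) (js : seq I) (lam : I -> V -> R)
    (K s tau : R) (X : set V) :
  0 < K -> (forall i x y, `|lam i x - lam i y| <= K * `|x - y|) -> 0 < tau ->
  uniq js -> (size js)%:R + 1 < s -> null s X ->
  exists eta : I -> R, (forall i, `|eta i| < tau) /\
    null (s - (size js)%:R) (X `&` [set x | forall i, i \in js -> lam i x = eta i]).
Proof.
move=> K0 lamK tau0; elim: js => [|j js IH] /=.
  move=> _ _ nX; exists (fun=> 0); split; first by rewrite normr0.
  by rewrite subr0; apply: nullS nX => x [].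
move=> /andP[jjs ujs]; rewrite -natr1 => js_s nX.
have [|eta [eta_tau neta]] := IH ujs _ nX; first by lra.
have tt : - tau < tau by lra.
have s1 : 1 < s - (size js)%:R by lra.
have [t t_tau nt] := null_slice K0 (lamK j) tt s1 neta.
exists (fun i => if i \in js then eta i else t); split.
  by move=> i; case: ifP => // _; rewrite ltr_norml.
rewrite opprD addrA; apply: nullS nt => x [Xx xe]; split; last first.
  by rewrite /= xe ?mem_head// (negPf jjs).
by split=> // i ijs; rewrite xe ?in_cons ?ijs ?orbT.
Qed.

End geometry.

(** * Sets that are locally affine *)

Section linear.
Context {R : realType}.

(** From a point p common to both, a small multiple of each direction of P stays in
    V, hence is a direction of Q. *)
Lemma affine_subspace_sub N d d' (P Q V : set 'rV[R]_N) p :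
  affine_subspace d P -> affine_subspace d' Q -> open V -> V p -> P p ->
  P `&` V `<=` Q -> P `<=` Q.
Proof.
move=> [a [A [_ ->]]] [b [B [_ ->]]] oV Vp /= Ap PQ x /= Ax.
have [e /= e0 eV] : nbhs_ball p V by apply/nbhs_ballP; exact: open_nbhs_nbhs.
pose t := e / (`|x - p| + 1).
have xp0 : 0 < `|x - p| + 1 by rewrite ltr_wpDl.
have t0 : 0 < t by rewrite divr_gt0.
pose y := p + t *: (x - p).
have Vy : V y.
  apply: eV; rewrite -ball_normE /ball_/= /y opprD addrA subrr add0r normrN.
  rewrite normrZ gtr0_norm// /t mulrAC ltr_pdivrMr// ltr_pM2l//.
  by rewrite ltrDl.
have Ay : (y - a <= A)%MS.
  have -> : y - a = (p - a) + t *: ((x - a) - (p - a)).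
    by rewrite /y opprB addrA subrK addrAC.
  by rewrite addmx_sub// scalemx_sub// addmx_sub// -scaleN1r scalemx_sub.
have Bp := PQ _ (conj Ap Vp); have By := PQ _ (conj Ay Vy).
have Bxp : (x - p <= B)%MS.
  have -> : x - p = t^-1 *: ((y - b) - (p - b)).
    rewrite opprB addrA subrK /y addrC addKr scalerA mulVf ?scale1r// gt_eqF//.
  by rewrite scalemx_sub// addmx_sub// -scaleN1r scalemx_sub.
by rewrite -(subrK p x) -addrA addmx_sub.
Qed.

(** The points near which M coincides with one fixed affine subspace P form a
    clopen subset of M: an affine subspace is determined by any nonempty relatively
    open part. *)
Lemma locally_affine_linear N (M : set 'rV[R]_N) : M !=set0 -> connected M ->
  (forall p, M p -> exists d (P U : set 'rV[R]_N),
     [/\ affine_subspace d P, open U, U p & M `&` U = P `&` U]) ->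
  linear_submanifold M.
Proof.
move=> [p0 Mp0] cM loc.
have [d [P [U0 [aP oU0 U0p MU0]]]] := loc _ Mp0.
pose good (V : set 'rV[R]_N) := open V /\ M `&` V = P `&` V.
pose O := \bigcup_(V in good) V.
have oO : open O by apply: bigcup_open => V [].
have MO : M `<=` O.
  suff <- : M `&` O = M by move=> x [].
  apply: cM; first by exists p0; split=> //; exists U0.
    by exists O.
  (* The complement of O in M is relatively open as well. *)
  pose bad (V : set 'rV[R]_N) := open V /\ forall x, V x -> M x -> ~ O x.
  exists (~` \bigcup_(V in bad) V).
    by apply: open_closedC; apply: bigcup_open => V [].
  apply/seteqP; split=> x [Mx Ox]; split=> //.
    by move=> [V [_ nV] Vx]; exact: nV Vx Mx Ox.
  have [d' [Q [U [aQ oU Ux MU]]]] := loc _ Mx.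
  apply: contrapT => nOx; apply: Ox; exists U => //; split=> // y Uy My [V [oV MV] Vy].
  have Py : P y by have [] : (P `&` V) y by rewrite -MV.
  have Qy : Q y by have [] : (Q `&` U) y by rewrite -MU.
  have oUV : open (U `&` V) by exact: openI.
  have PQ : P `<=` Q.
    apply: (affine_subspace_sub aP aQ oUV (conj Uy Vy) Py) => z [Pz [Uz Vz]].
    have [Mz _] : (M `&` V) z by rewrite MV.
    by have [] : (Q `&` U) z by rewrite -MU.
  have QP : Q `<=` P.
    apply: (affine_subspace_sub aQ aP oUV (conj Uy Vy) Qy) => z [Qz [Uz Vz]].
    have [Mz _] : (M `&` U) z by rewrite MU.
    by have [] : (P `&` V) z by rewrite -MV.
  apply: nOx; exists U => //; split=> //; rewrite MU.
  by congr (_ `&` _); apply/seteqP.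
exists d, P; split=> //; exists O => //.
apply/seteqP; split=> x.
  move=> Mx; have [V [oV MV] Vx] := MO _ Mx; split; last by exists V.
  by have [] : (P `&` V) x by rewrite -MV.
by move=> [Px [V [oV MV] Vx]]; have [] : (M `&` V) x by rewrite MV.
Qed.

Lemma set0_linear N : linear_submanifold (set0 : set 'rV[R]_N).
Proof.
exists 0%N, [set x | (x - 0 <= (0 : 'M[R]_N))%MS]; split.
  by exists 0, 0; rewrite mxrank0.
by exists set0; [exact: open0|rewrite setI0].
Qed.

(** The affine subspace is the translate, through the given point, of the image
    under Q of the graph of L. *)
Lemma affine_graph_chart n (M U : set 'rV[R]_(n + 1)) (W : set 'rV[R]_n)
    (f : 'rV[R]_n -> 'rV[R]_1) (Q : 'M[R]_(n + 1)) (v : 'rV[R]_(n + 1))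
    (x0 : 'rV[R]_n) (L : 'M[R]_(n, 1)) (rho : R) :
  Q *m Q^T = 1%:M -> open U -> U (row_mx x0 (f x0) *m Q + v) -> 0 < rho ->
  M `&` U = (fun z => z *m Q + v) @` graph_over W f ->
  (forall x, `|x - x0| < rho -> W x /\ f x = f x0 + (x - x0) *m L) ->
  exists d (P U' : set 'rV[R]_(n + 1)),
     [/\ affine_subspace d P, open U', U' (row_mx x0 (f x0) *m Q + v) & M `&` U' = P `&` U'].
Proof.
move=> QQ oU Up rho0 MU faff.
set p := row_mx x0 (f x0) *m Q + v.
pose h (z : 'rV[R]_(n + 1)) := lsubmx ((z - v) *m Q^T).
have hE x y : h (row_mx x y *m Q + v) = x.
  by rewrite /h addrK -mulmxA QQ mulmx1 row_mxKl.
have [K K0 QK] := mulmx_lipschitz Q^T.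
have hK z w : `|h z - h w| <= K * `|z - w|.
  have -> : h z - h w = lsubmx ((z - w) *m Q^T).
    by rewrite /h -linearB/= -mulmxBl opprB addrA subrK.
  apply: le_trans (QK _); apply: rV_norm_le => // j.
  by rewrite mxE; exact: le_rV_norm.
pose V := row_mx 1%:M L *m Q.
pose B := [set z | `|h z - x0| < rho].
have oB : open B.
  rewrite openE => z Bz; apply/nbhs_ballP.
  exists ((rho - `|h z - x0|) / K); first by rewrite /= divr_gt0// subr_gt0.
  move=> w; rewrite -ball_normE /ball_/= ltr_pdivlMr// mulrC => zw.
  rewrite /B/= -(subrK (h z) (h w)) -addrA.
  apply: (le_lt_trans (ler_normD _ _)); rewrite -ltrBrDr.
  by apply: le_lt_trans zw; rewrite distrC.
exists (\rank <<V>>%MS), [set z | (z - p <= <<V>>%MS)%MS], (U `&` B); split.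
- by exists p, <<V>>%MS.
- exact: openI.
- by split=> //; rewrite /B/= hE subrr normr0.
- apply/seteqP; split=> z [Az [Uz Bz]]; split=> //.
    have : (M `&` U) z by [].
    rewrite MU => -[_ [x Wx <-] zE].
    have hx : h z = x by rewrite -zE hE.
    move: Bz; rewrite /B/= hx => /faff[_ fx].
    rewrite genmxE; apply/submxP; exists (x - x0).
    rewrite -zE /p opprD addrACA subrr addr0 -mulmxBl fx opp_row_mx add_row_mx.
    by rewrite /V mulmxA mul_mx_row mulmx1 addrAC subrr add0r.
  move: Az; rewrite /= genmxE => /submxP[D zD].
  have zE : z = row_mx (x0 + D) (f x0 + D *m L) *m Q + v.
    rewrite -(subrK p z) zD /p /V mulmxA mul_mx_row mulmx1 addrA -mulmxDl.
    by rewrite add_row_mx [D + _]addrC [_ *m L + _]addrC.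
  move: Bz; rewrite /B/= zE hE => /faff[WD].
  rewrite [x0 + D]addrC addrK => fD.
  suff [] : (M `&` U) (row_mx (D + x0) (f x0 + D *m L) *m Q + v) by [].
  rewrite MU -fD; exists (row_mx (D + x0) (f (D + x0))) => //.
  by exists (D + x0) => //; rewrite addrC.
Qed.

End linear.

(** * Null covers of a graph by hyperplanes *)

Section main.
Context {R : realType}.

(** The plane of the vectors (u e, v) has dimension 2, so it meets the direction
    space of a hyperplane in a line at least. *)
Lemma hyperplane_line n (V Q : 'M[R]_(n + 1)) (e : 'rV[R]_n) : \rank V = n ->
  exists u v : R, (u != 0) || (v != 0) /\
    (row_mx (u *: e) (v%:M : 'M[R]_1) *m Q <= V)%MS.
Proof.
move=> rV; pose E : 'M[R]_(1 + 1, n + 1) := col_mx (row_mx e 0) (row_mx 0 1%:M) *m Q.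
pose F := E *m cokermx V.
have rF : (\rank F <= 1)%N.
  apply: (leq_trans (mxrankM_maxr _ _)).
  by rewrite mxrank_coker rV addKn.
have kF : kermx F != 0.
  rewrite -mxrank_eq0 mxrank_ker -lt0n subn_gt0.
  by apply: (leq_ltn_trans rF).
pose c := nz_row (kermx F).
have c0 : c != 0 by rewrite nz_row_eq0.
have cE : (c *m E <= V)%MS.
  by rewrite submxE -mulmxA; apply/eqP/sub_kermxP; exact: nz_row_sub.
pose u := lsubmx c 0 0; pose v := rsubmx c 0 0.
have lc : lsubmx c = u%:M by exact: mx11_scalar.
have rc : rsubmx c = v%:M by exact: mx11_scalar.
exists u, v; split.
  apply: contraR c0; rewrite negb_or !negbK => /andP[/eqP u0 /eqP v0].
  by rewrite -(hsubmxK c) lc rc u0 v0 !raddf0 row_mx0.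
move: cE; rewrite /E mulmxA -(hsubmxK c) mul_row_col lc rc.
rewrite !mul_mx_row !mulmx0 mulmx1 !mul_scalar_mx add_row_mx addr0 add0r.
by [].
Qed.

(** If f differs from its tangent map at x0 + e, the derivative of f in the
    direction e is not constant on the line x0 + t e, nor on its translates by
    small w.  Slicing by the n - 1 functionals z_j - (e_j / e_i) z_i, which are
    constant along e, provides such a w for which the plane through the translated
    line meets X in a null set; this contradicts [lines_derivative_constant]. *)
Lemma null_cover_affine n (X : set 'rV[R]_(n + 1)) (s : R)
    (f : 'rV[R]_n -> 'rV[R]_1) (Q : 'M[R]_(n + 1)) (v : 'rV[R]_(n + 1))
    (x0 : 'rV[R]_n) (rho K : R) :
  null s X -> n%:R < s < n%:R + 1 -> Q *m Q^T = 1%:M -> 0 < K ->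
  (forall x, `|x - x0| < rho -> differentiable f x) ->
  (forall x y, `|x - x0| < rho -> `|y - x0| < rho ->
     `|'J f x - 'J f y| <= K * `|x - y|) ->
  (forall x, `|x - x0| < rho -> exists2 P, hyperplane P /\ P `<=` X &
     P (row_mx x (f x) *m Q + v)) ->
  forall x, `|x - x0| < rho -> f x = f x0 + (x - x0) *m 'J f x0.
Proof.
move=> nX /andP[ns sn] QQ K0 df JK cov.
suff aff e : `|e| < rho -> f (x0 + e) = f x0 + e *m 'J f x0.
  by move=> x /aff; rewrite subrKC.
move=> erho; apply: contrapT => fx.
have e0 : e != 0 by apply/eqP => e0; apply: fx; rewrite e0 mul0mx !addr0.
have en0 : 0 < `|e| by rewrite normr_gt0.
pose gap := rho - `|e|; have gap0 : 0 < gap by rewrite subr_gt0.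
(* Room for t slightly outside [0, 1] and for translations by |w| < gap / 2 inside
   the ball of radius rho. *)
pose kap := gap / (2 * `|e|); have kap0 : 0 < kap by rewrite divr_gt0// mulr_gt0.
have kape : kap * `|e| = gap / 2 by rewrite /kap; field; rewrite gt_eqF.
have kk : - kap < 1 + kap by lra.
have k0 : - kap < 0 < 1 + kap by apply/andP; split; lra.
have inball (w : 'rV[R]_n) t : `|w| < gap / 2 -> - kap < t < 1 + kap ->
    `|x0 + w + t *: e - x0| < rho.
  move=> wgap /andP[t1 t2].
  have -> : x0 + w + t *: e - x0 = w + t *: e by rewrite -[x0 + _ + _]addrA [x0 + _]addrC addrK.
  apply: (le_lt_trans (ler_normD _ _)); rewrite normrZ.
  have : `|t| * `|e| <= (1 + kap) * `|e|.
    by rewrite ler_wpM2r// ler_norml; apply/andP; split; lra.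
  rewrite mulrDl mul1r kape /gap; move: wgap; rewrite /gap; lra.
pose G z := (e *m 'J f z) 0 0.
have [C C0 GC] : exists2 C, 0 < C & forall y z, `|y - x0| < rho -> `|z - x0| < rho ->
    `|G y - G z| <= C * `|y - z|.
  exists (n%:R * `|e| * K + K) => [|y z yr zr].
    by rewrite ltr_wpDl// mulr_ge0 ?mulr_ge0// ltW.
  rewrite /G.
  have -> : (e *m 'J f y) 0 0 - (e *m 'J f z) 0 0 = (e *m ('J f y - 'J f z)) 0 0.
    have BE (A B : 'M[R]_1) : (A - B) 0 0 = A 0 0 - B 0 0 by rewrite !mxE.
    by rewrite mulmxBr BE.
  rewrite mxE mulrDl; apply: (le_trans (ler_norm_sum _ _ _)).
  apply: (@le_trans _ _ (\sum_(i < n) `|e| * (K * `|y - z|))).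
    apply: ler_sum => i _; rewrite normrM; apply: ler_pM => //.
      exact: le_rV_norm.
    apply: le_trans (JK _ _ yr zr); rewrite [leRHS]mx_normrE.
    by apply: (le_bigmax_cond _ (fun ij => `|('J f y - 'J f z) ij.1 ij.2|) (j := (i, 0))).
  rewrite sumr_const card_ord -[leLHS]mulr_natl !mulrA lerDl mulr_ge0//.
  exact: ltW.
have w00 : `|0 : 'rV[R]_n| < gap / 2 by rewrite normr0 divr_gt0.
have lineD (w : 'rV[R]_n) t : `|w| < gap / 2 -> - kap < t < 1 + kap ->
    is_derive t 1 (fun t : R => f (x0 + w + t *: e) 0 0) (G (x0 + w + t *: e)).
  by move=> wg tk; apply: line_is_derive; apply: df; exact: inball.
have [t1 t1k Gt1] : exists2 t1, - kap < t1 < 1 + kap & G (x0 + t1 *: e) != G x0.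
  have [||t] := @MVT_segment R (fun t : R => f (x0 + 0 + t *: e) 0 0)
      (fun t => G (x0 + 0 + t *: e)) 0 1 ler01.
  - by move=> t; rewrite in_itv/= => /andP[? ?]; apply: lineD => //; lra.
  - apply: derivable_within_continuous => t; rewrite in_itv/= => /andP[? ?].
    have tk : - kap < t < 1 + kap by lra.
    by have [] := lineD 0 t w00 tk.
  rewrite in_itv/= subr0 mulr1 scale0r scale1r !addr0 => /andP[? ?] ft.
  exists t; first lra.
  apply/eqP => GG; apply: fx; apply/rowP => i; rewrite (ord1 i) [RHS]mxE.
  move: ft; rewrite GG /G => <-.
  by rewrite subrKC.
pose D0 := `|G (x0 + t1 *: e) - G x0|.
have D00 : 0 < D0 by rewrite normr_gt0 subr_eq0.
(* By the Lipschitz bound on G, translations by less than D0 / (2 C) keep the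
   values of G at t = 0 and t = t1 distinct. *)
pose tau := Num.min (gap / 2) (D0 / (2 * C)).
have tau0 : 0 < tau by rewrite lt_min !divr_gt0// mulr_gt0.
have tauD : tau * (2 * C) <= D0.
  by rewrite -ler_pdivlMr ?mulr_gt0// /tau ge_min lexx orbT.
have [i ei0] : exists i, e 0 i != 0.
  apply: contrapT => noi; move/eqP: e0; apply; apply/rowP => i; rewrite [RHS]mxE.
  by apply/eqP/negPn/negP => ei; apply: noi; exists i.
pose y (z : 'rV[R]_(n + 1)) := lsubmx ((z - v) *m Q^T) - x0.
pose hgt (z : 'rV[R]_(n + 1)) := rsubmx ((z - v) *m Q^T) 0 0.
have yE a (b : 'rV[R]_1) : y (row_mx a b *m Q + v) = a - x0.
  by rewrite /y addrK -mulmxA QQ mulmx1 row_mxKl.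
have hE a (b : 'rV[R]_1) : hgt (row_mx a b *m Q + v) = b 0 0.
  by rewrite /hgt addrK -mulmxA QQ mulmx1 row_mxKr.
have [KQ KQ0 QK] := mulmx_lipschitz Q^T.
have yK j z z' : `|y z 0 j - y z' 0 j| <= KQ * `|z - z'|.
  have -> : y z 0 j - y z' 0 j = ((z - z') *m Q^T) 0 (lshift 1 j).
    by rewrite /y !mulmxBl !mxE; ring.
  by apply: le_trans (QK _); exact: le_rV_norm.
have hK z z' : `|hgt z - hgt z'| <= KQ * `|z - z'|.
  have -> : hgt z - hgt z' = ((z - z') *m Q^T) 0 (rshift n 0).
    by rewrite /hgt !mulmxBl !mxE; ring.
  by apply: le_trans (QK _); exact: le_rV_norm.
pose lam j z := y z 0 j - e 0 j / e 0 i * y z 0 i.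
pose eta0 := `|e| / `|e 0 i|.
have eta00 : 0 <= eta0 by rewrite divr_ge0.
have lamK j z z' : `|lam j z - lam j z'| <= (KQ + eta0 * KQ) * `|z - z'|.
  have -> : lam j z - lam j z' = (y z 0 j - y z' 0 j) - e 0 j / e 0 i * (y z 0 i - y z' 0 i).
    by rewrite /lam; ring.
  apply: (le_trans (ler_normB _ _)); rewrite mulrDl lerD// normrM -mulrA.
  apply: ler_pM => //; rewrite normrM normfV /eta0 ler_wpM2r ?invr_ge0//.
  exact: le_rV_norm.
pose js := [seq j <- enum 'I_n | j != i].
have ujs : uniq js by rewrite filter_uniq// enum_uniq.
have n0 : (0 < n)%N by apply: leq_ltn_trans (ltn_ord i).
have sjs : size js = n.-1.
  have := count_predC (pred1 i) (enum 'I_n).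
  rewrite count_uniq_mem ?enum_uniq// mem_enum size_enum_ord add1n => nE.
  by rewrite size_filter -[in RHS]nE.
have KL0 : 0 < KQ + eta0 * KQ by rewrite ltr_pwDl// mulr_ge0// ltW.
have jsR : (size js)%:R + 1 = n%:R :> R by rewrite sjs natr1 prednK.
have [|eta [eta_tau nS]] := null_slices KL0 lamK tau0 ujs _ nX; first by rewrite jsR.
pose w : 'rV[R]_n := \row_j (if j == i then 0 else eta j).
have wtau : `|w| < tau.
  by apply: rV_norm_lt => // j; rewrite mxE; case: ifP => // _; rewrite normr0.
have wgap : `|w| < gap / 2 by apply: (lt_le_trans wtau); rewrite ge_min lexx.
pose pt (t h : R) := row_mx (x0 + w + t *: e) (h%:M : 'M[R]_1) *m Q + v.
pose U2 := [set th : R * R | X (pt th.1 th.2)].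
have nU2 : null (s - (size js)%:R) U2.
  (* Coordinates (t, h) in the plane of the slice. *)
  pose Psi (z : 'rV[R]_(n + 1)) : R * R := (y z 0 i / e 0 i, hgt z).
  have PsiK z z' : `|Psi z - Psi z'| <= (KQ / `|e 0 i| + KQ) * `|z - z'|.
    rewrite prod_normE/= ge_max; apply/andP; split.
      rewrite -mulrBl normrM normfV.
      apply: (@le_trans _ _ (KQ / `|e 0 i| * `|z - z'|)).
        by rewrite mulrAC ler_wpM2r ?invr_ge0.
      by rewrite ler_wpM2r// lerDl ltW.
    apply: (le_trans (hK _ _)); rewrite ler_wpM2r// lerDr.
    by rewrite divr_ge0// ltW.
  have KP0 : 0 < KQ / `|e 0 i| + KQ by rewrite ltr_wpDl// divr_ge0// ltW.
  apply: nullS (null_lipschitz_image (f := Psi) KP0 (fun z z' _ _ => PsiK z z') nS).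
  move=> [t h] /= Xth; exists (pt t h).
    split=> // j; rewrite mem_filter => /andP[ji _].
    rewrite /lam yE !mxE (negPf ji) eqxx.
    have -> : x0 0 j + eta j + t * e 0 j - x0 0 j -
      e 0 j / e 0 i * (x0 0 i + 0 + t * e 0 i - x0 0 i) = eta j by field.
    by [].
  rewrite /Psi hE yE !mxE eqxx mulr1n; congr (_, _).
  by field.
have s2 : 1 < s - (size js)%:R < 2.
  rewrite ltrBrDr [1 + _]addrC jsR ns/= ltrBlDr.
  by rewrite (_ : 2 + _ = n%:R + 1)// -jsR addrC -addrA.
pose phi (t : R) := f (x0 + w + t *: e) 0 0.
have const := @lines_derivative_constant R (- kap) (1 + kap) (C * `|e|) phi
  (fun t => G (x0 + w + t *: e)) kk _ _ _ U2 _ s2 nU2.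
have /eqP : G (x0 + w + t1 *: e) = G (x0 + w + 0 *: e).
  apply: const => //=.
  - by rewrite mulr_gt0.
  - by move=> t tk; exact: lineD.
  - move=> t t' tk t'k; apply: (le_trans (GC _ _ (inball _ _ wgap tk) (inball _ _ wgap t'k))).
    by rewrite opprD addrACA subrr add0r -scalerBl normrZ mulrA mulrAC.
  - move=> t tk; have [P [[a [A [rA PE]]] PX] Pt] := cov _ (inball _ _ wgap tk).
    have [u [b [ub uA]]] := hyperplane_line Q e rA.
    exists u, b; split=> // r; rewrite /U2/=; apply: PX; rewrite PE/=.
    have -> : pt (t + r * u) (phi t + r * b) - a =
        (row_mx (x0 + w + t *: e) (f (x0 + w + t *: e)) *m Q + v - a) +
        r *: (row_mx (u *: e) (b%:M : 'M[R]_1) *m Q).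
      rewrite /pt scalemxAl scale_row_mx.
      have -> : row_mx (x0 + w + (t + r * u) *: e) (phi t + r * b)%:M =
          row_mx (x0 + w + t *: e) (f (x0 + w + t *: e)) +
          row_mx (r *: (u *: e)) (r *: b%:M).
        rewrite add_row_mx scalerDl addrA scalerA; congr row_mx.
        by rewrite raddfD/= scale_scalar_mx /phi -mx11_scalar.
      rewrite mulmxDl -!addrA; congr (_ + _).
      by rewrite addrC -addrA.
    by rewrite addmx_sub ?scalemx_sub//; move: Pt; rewrite PE.
rewrite scale0r addr0; apply/negP; apply/eqP => GG.
have wC : 2 * C * `|w| < D0.
  have C20 : 0 < 2 * C by rewrite mulr_gt0.
  by apply: lt_le_trans tauD; rewrite mulrC ltr_pM2r.
have b1 := inball _ _ w00 t1k; have b2 := inball _ _ wgap t1k.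
have b3 := inball _ _ wgap k0; have b4 := inball _ _ w00 k0.
move: b1 b3 b4; rewrite !scale0r !addr0 => b1 b3 b4.
have d1 := GC _ _ b1 b2; have d2 := GC _ _ b3 b4.
have n1 : `|x0 + t1 *: e - (x0 + w + t1 *: e)| = `|w|.
  by rewrite opprD addrACA subrr addr0 opprD addNKr normrN.
have n2 : `|x0 + w - x0| = `|w| by rewrite addrAC subrr add0r.
rewrite n1 in d1; rewrite n2 in d2; move: wC d1 d2 GG; rewrite /D0.
move: (G (x0 + t1 *: e)) (G (x0 + w + t1 *: e)) (G (x0 + w)) (G x0) (C * `|w|) (mulrA 2 C `|w|).
move=> a b c d m <- wC d1 d2 bc; move: wC; apply/negP; rewrite -leNgt.
have -> : a - d = (a - b) + (c - d) by rewrite bc addrA subrK.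
by rewrite mulr_natl mulr2n; apply: (le_trans (ler_normD _ _)); exact: lerD.
Qed.

End main.

Lemma null_cover_linear (R : realType) (n : nat) (M X : set 'rV[R]_(n + 1)) (s : R) :
  @lipschitz_C1_submanifold R n 1 M -> n%:R < s < n%:R + 1 -> null s X ->
  (forall p, M p -> exists2 P, hyperplane P /\ P `<=` X & P p) ->
  linear_submanifold M.
Proof.
move=> [[[connM _] _] chartM] sn nX cov.
have [->|/set0P M0] := eqVneq M set0; first exact: set0_linear.
apply: locally_affine_linear => // p Mp.
have [U [W [f [g [[oU Up] oW [[df _] lipf] [Q [v [QQ gE]]] MU]]]]] := chartM p Mp.
have gE' : g = (fun z => z *m Q + v) by apply/funext.
rewrite gE' in MU.
have : (M `&` U) p by [].
rewrite MU => -[_ [x0 Wx0 <-] pE].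
have [V Vx0 /lipschitz_jacobian_bound[K K0 JK]] := lipf x0 Wx0.
have [rho /= rho0 rhoWV] : nbhs_ball x0 (W `&` V).
  by apply/nbhs_ballP; apply: filterI => //; exact: open_nbhs_nbhs.
have ballWV x : `|x - x0| < rho -> W x /\ V x.
  by move=> xr; apply: rhoWV; rewrite -ball_normE /ball_/= distrC.
rewrite -pE; apply: (affine_graph_chart (U := U) (f := f) (W := W) (L := 'J f x0) (rho := rho)) => //.
  by rewrite pE.
move=> x xr; have [Wx Vx] := ballWV _ xr; split=> //.
apply: (@null_cover_affine R n X s f Q v x0 rho K) => //.
- by move=> z /ballWV[/df].
- by move=> z z' /ballWV[_ Vz] /ballWV[_ Vz']; exact: JK.
- move=> z /ballWV[Wz _]; apply: cov.
  have [] // : (M `&` U) (row_mx z (f z) *m Q + v).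
  by rewrite MU; exists (row_mx z (f z)) => //; exists z.
Qed.

(** * Hausdorff dimension of the union *)

Theorem theorem3p2p1 (R : realType) (n : nat) (M : set 'rV[R]_(n + 1))
    (M_lipC1 : @lipschitz_C1_submanifold R n 1 M)
    (M_nonlinear : ~ linear_submanifold M)
    (A : set (set 'rV[R]_(n + 1)))
    (A_hyperplanes : forall P, A P -> hyperplane P)
    (A_covers : M `<=` \bigcup_(P in A) P) :
  hausdorff_dim (\bigcup_(P in A) P) = ((n + 1)%N%:R : R)%:E.
Proof.
set X := \bigcup_(P in A) P.
apply/eqP; rewrite eq_le; apply/andP; split.
  apply/lee_addgt0Pr => e e0; rewrite -EFinD; apply: ereal_inf_lbound.
  have s0 : 0 < (n + 1)%N%:R + e by rewrite ltr_wpDl.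
  exists ((n + 1)%N%:R + e) => //; split; first exact: ltW.
  apply: null_hausdorff => //; apply: nullS (@null_setT R (n + 1) _ _) => //.
  by rewrite ltrDl.
apply: le_ereal_inf_tmp => _ [s /= [s0 Hs] <-]; rewrite lee_fin leNgt.
apply/negP => sn; apply: M_nonlinear; rewrite natrD in sn.
(* Increasing the exponent keeps the set null, and slicing needs s > n. *)
pose s' := Num.max s (n%:R + 2^-1).
have n0 : 0 <= n%:R :> R by [].
have s'n : n%:R < s' < n%:R + 1.
  by rewrite lt_max gt_max sn; apply/andP; split; first (apply/orP; right); lra.
have nX : null s' X.
  apply: (hausdorff_null _ _ Hs); first by rewrite s0 le_max lexx.
  by case/andP: s'n => h _; apply: le_lt_trans h.
apply: (@null_cover_linear R n M X s' M_lipC1 s'n nX) => p /A_covers[P AP Pp].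
by exists P => //; split; [exact: A_hyperplanes|move=> z Pz; exists P].
Qed.
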